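(* Consider a robust Markov decision process with $S$ states, $A$ actions and the $s$-rectangular $\chi^2$-distance ambiguity set ($\phi(t)=(t-1)^2$) with budget $\kappa>0$ described in the context, with robust Bellman operator $\mathfrak{J}$. For every $\bm{v}\in\mathbb{R}^S$ with $\bm{v}\le\bm{v}^\star$ and $\bm{r}_{sa}+\lambda\bm{v}\ge\bm{0}$ for all $s\in\mathcal{S}$, $a\in\mathcal{A}$, the robust Bellman iteration $\mathfrak{J}(\bm{v})$ (across all states) can be computed to any accuracy $\epsilon>0$ in time $$\mathcal{O}\left(S^2\log S\cdot A\cdot\log\frac{\overline{R}}{\epsilon}\right).$$
   Context: Notation: $\Delta_n=\{\bm{p}\in\mathbb{R}^n_+ : \mathbf{e}^\top\bm{p}=1\}$ with $\mathbf{e}$ the all-ones vector. Inequalities between vectors are component-wise. Robust MDP: finite state space $\mathcal{S}=\{1,\dots,S\}$, finite action space $\mathcal{A}=\{1,\dots,A\}$, discount factor $\lambda\in(0,1)$, rewards $r_{sas'}\in\mathbb{R}_+$ with $\bm{r}_{sa}=(r_{sas'})_{s'\in\mathcal{S}}$, nominal transition probabilities $\overline{\bm{p}}_{sa}\in\Delta_S$ with $\overline{\bm{p}}_{sa}>\bm{0}$. With $\phi(t)=(t-1)^2$, let $d_a(\bm{p}_{sa},\overline{\bm{p}}_{sa})=\sum_{s'\in\mathcal{S}}\overline{p}_{sas'}\,\phi(p_{sas'}/\overline{p}_{sas'})=\sum_{s'\in\mathcal{S}}(p_{sas'}-\overline{p}_{sas'})^2/\overline{p}_{sas'}$. For a budget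 $\kappa>0$, the ambiguity set of state $s$ is $\mathcal{P}_s=\{\bm{p}_s=(\bm{p}_{sa})_{a\in\mathcal{A}}\in(\Delta_S)^A : \sum_{a\in\mathcal{A}}d_a(\bm{p}_{sa},\overline{\bm{p}}_{sa})\le\kappa\}$. The robust Bellman operator $\mathfrak{J}:\mathbb{R}^S\to\mathbb{R}^S$ is $$[\mathfrak{J}(\bm{v})]_s=\max_{\bm{\pi}_s\in\Delta_A}\ \min_{\bm{p}_s\in\mathcal{P}_s}\ \sum_{a\in\mathcal{A}}\pi_{sa}\cdot\bm{p}_{sa}^\top(\bm{r}_{sa}+\lambda\bm{v}),\qquad s\in\mathcal{S},$$ and $\bm{v}^\star$ denotes the limit of the iteration $\bm{v}^{t+1}=\mathfrak{J}(\bm{v}^t)$ (the fixed point of $\mathfrak{J}$). Further, $\overline{R}=(1-\lambda)^{-1}\max\{r_{sas'} : s,s'\in\mathcal{S},\ a\in\mathcal{A}\}$. $\mathfrak{J}(\bm{v})$ is computed to accuracy $\epsilon$ by any $\bm{v}'\in\mathbb{R}^S$ with $\|\bm{v}'-\mathfrak{J}(\bm{v})\|_\infty\le\epsilon$. Running time counts elementary operations on real numbers (arithmetic operations and comparisons), each at unit cost. *)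

(* Defs.v *)
From mathcomp Require Import all_boot all_order all_algebra.
From mathcomp Require Import classical_sets reals topology normedtype.
From mathcomp Require Import sequences exp.

Set Implicit Arguments.
Unset Strict Implicit.
Unset Printing Implicit Defensive.

Import Order.TTheory GRing.Theory Num.Theory.
Import numFieldNormedType.Exports.
Local Open Scope classical_set_scope.
Local Open Scope ring_scope.

Definition simplex (R : realType) (n : nat) : set ('I_n -> R) :=
  [set p | (forall i, 0 <= p i) /\ \sum_(i < n) p i = 1].
Arguments simplex R n : clear implicits.

Record rmdp (R : realType) (nS nA : nat) := RMDP {
  rew : 'I_nS -> 'I_nA -> 'I_nS -> R;
  pbar : 'I_nS -> 'I_nA -> 'I_nS -> R;
  disc : R;
  budget : R;
  rew_ge0 : forall s a s', 0 <= rew s a s';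
  pbar_simplex : forall s a, simplex R nS (pbar s a);
  pbar_gt0 : forall s a s', 0 < pbar s a s';
  disc_gt0 : 0 < disc;
  disc_lt1 : disc < 1;
  budget_gt0 : 0 < budget }.

Definition phi (R : realType) (t : R) : R := (t - 1) ^+ 2.

Definition divergence (R : realType) (n : nat) (p q : 'I_n -> R) : R :=
  \sum_(i < n) q i * phi (p i / q i).

Section Bellman.
Variables (R : realType) (nS nA : nat) (M : rmdp R nS nA).

Definition ambiguity (s : 'I_nS) : set ('I_nA -> 'I_nS -> R) :=
  [set p | (forall a, simplex R nS (p a)) /\
           \sum_(a < nA) divergence (p a) (pbar M s a) <= budget M].

Definition expected_value (v : 'I_nS -> R) (s : 'I_nS)
    (pi : 'I_nA -> R) (p : 'I_nA -> 'I_nS -> R) : R :=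
  \sum_(a < nA) pi a * \sum_(s' < nS) p a s' * (rew M s a s' + disc M * v s').

(* For [0 < nA] both extrema are attained: the simplex and the ambiguity set
   are nonempty and compact and the objective is continuous. *)
Definition bellman (v : 'I_nS -> R) : 'I_nS -> R := fun s =>
  sup [set inf [set expected_value v s pi p | p in ambiguity s]
      | pi in simplex R nA].

(* [bellman] is a [disc M]-contraction for the maximum norm, so the limit
   exists and does not depend on the starting point. *)
Definition vstar : 'I_nS -> R := fun s =>
  limn (fun t => iter t bellman (fun=> 0) s).

(* The rewards are nonnegative, hence the neutral element 0 of the maximum. *)
Definition Rbar : R :=
  (1 - disc M)^-1 *
  \big[Num.max/0]_(s < nS) \big[Num.max/0]_(a < nA)
    \big[Num.max/0]_(s' < nS) rew M s a s'.

End Bellman.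

Definition dist_infty (R : realType) (n : nat) (x y : 'I_n -> R) : R :=
  \big[Num.max/0]_(i < n) `|x i - y i|.

(* Programs are finite and mention no real constants but natural numbers.
   Memory consists of integer registers, used for control flow and indexing,
   and of real banks, each an infinite array. Reals and integers cannot be
   converted into each other, and reals influence control flow and indexing
   only through comparisons. *)

Inductive iexp : Type :=
| INum (n : nat)
| IReg (x : nat)
| IAdd (e1 e2 : iexp)
| ISub (e1 e2 : iexp)
| IMul (e1 e2 : iexp).

Inductive rexp : Type :=
| RNum (n : nat)
| RMem (b : nat) (e : iexp)
| RAdd (r1 r2 : rexp)
| RSub (r1 r2 : rexp)
| RMul (r1 r2 : rexp)
| RDiv (r1 r2 : rexp).

Inductive bexp : Type :=
| BILe (e1 e2 : iexp)
| BRLe (r1 r2 : rexp)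
| BNot (b : bexp)
| BAnd (b1 b2 : bexp).

Inductive cmd : Type :=
| Skip
| ISet (x : nat) (e : iexp)
| RSet (b : nat) (e : iexp) (r : rexp)
| Seq (c1 c2 : cmd)
| If (b : bexp) (c1 c2 : cmd)
| While (b : bexp) (c : cmd).

Record state (R : realType) := State {
  ireg : nat -> nat;
  rmem : nat -> nat -> R }.

Definition set_ireg (R : realType) (st : state R) (x n : nat) : state R :=
  State (fun y => if y == x then n else ireg st y) (rmem st).

Definition set_rmem (R : realType) (st : state R) (b i : nat) (z : R) :
    state R :=
  State (ireg st)
    (fun c j => if (c == b) && (j == i) then z else rmem st c j).

Fixpoint ieval (R : realType) (st : state R) (e : iexp) : nat :=
  match e with
  | INum n => n
  | IReg x => ireg st x
  | IAdd e1 e2 => (ieval st e1 + ieval st e2)%N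
  | ISub e1 e2 => (ieval st e1 - ieval st e2)%N
  | IMul e1 e2 => (ieval st e1 * ieval st e2)%N
  end.

(* A division by zero returns 0. *)
Fixpoint reval (R : realType) (st : state R) (r : rexp) : R :=
  match r with
  | RNum n => n%:R
  | RMem b e => rmem st b (ieval st e)
  | RAdd r1 r2 => reval st r1 + reval st r2
  | RSub r1 r2 => reval st r1 - reval st r2
  | RMul r1 r2 => reval st r1 * reval st r2
  | RDiv r1 r2 => reval st r1 / reval st r2
  end.

Fixpoint beval (R : realType) (st : state R) (b : bexp) : bool :=
  match b with
  | BILe e1 e2 => (ieval st e1 <= ieval st e2)%N
  | BRLe r1 r2 => reval st r1 <= reval st r2
  | BNot b1 => ~~ beval st b1
  | BAnd b1 b2 => beval st b1 && beval st b2
  end.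

(* Every node of an expression has unit cost, so that index computations and
   memory accesses are charged on top of the operations on reals. *)
Fixpoint icost (e : iexp) : nat :=
  match e with
  | INum _ | IReg _ => 1
  | IAdd e1 e2 | ISub e1 e2 | IMul e1 e2 => (icost e1 + icost e2).+1
  end.

Fixpoint rcost (r : rexp) : nat :=
  match r with
  | RNum _ => 1
  | RMem _ e => (icost e).+1
  | RAdd r1 r2 | RSub r1 r2 | RMul r1 r2 | RDiv r1 r2 =>
      (rcost r1 + rcost r2).+1
  end.

Fixpoint bcost (b : bexp) : nat :=
  match b with
  | BILe e1 e2 => (icost e1 + icost e2).+1
  | BRLe r1 r2 => (rcost r1 + rcost r2).+1
  | BNot b1 => (bcost b1).+1
  | BAnd b1 b2 => (bcost b1 + bcost b2).+1
  end.

(* [exec c st t st']: started in [st], [c] halts in [st'] after time [t]. *)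
Inductive exec (R : realType) : cmd -> state R -> nat -> state R -> Prop :=
| ExecSkip st : exec Skip st 1 st
| ExecISet st x e :
    exec (ISet x e) st (icost e).+1 (set_ireg st x (ieval st e))
| ExecRSet st b e r :
    exec (RSet b e r) st (icost e + rcost r).+1
      (set_rmem st b (ieval st e) (reval st r))
| ExecSeq c1 c2 st st1 st2 t1 t2 :
    exec c1 st t1 st1 -> exec c2 st1 t2 st2 ->
    exec (Seq c1 c2) st (t1 + t2) st2
| ExecIfTrue b c1 c2 st st' t :
    beval st b -> exec c1 st t st' ->
    exec (If b c1 c2) st (bcost b + t).+1 st'
| ExecIfFalse b c1 c2 st st' t :
    ~~ beval st b -> exec c2 st t st' ->
    exec (If b c1 c2) st (bcost b + t).+1 st'
| ExecWhileFalse b c st :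
    ~~ beval st b -> exec (While b c) st (bcost b).+1 st
| ExecWhileTrue b c st st1 st2 t1 t2 :
    beval st b -> exec c st t1 st1 -> exec (While b c) st1 t2 st2 ->
    exec (While b c) st (bcost b + t1 + t2).+1 st2.

(* Three-dimensional arrays are stored in row-major order. Registers and cells
   that do not hold input have arbitrary contents. *)
Definition holds_input (R : realType) (nS nA : nat) (M : rmdp R nS nA)
    (v : 'I_nS -> R) (eps : R) (st : state R) : Prop :=
  [/\ ireg st 0%N = nS /\ ireg st 1%N = nA,
      forall (s : 'I_nS) (a : 'I_nA) (s' : 'I_nS),
        rmem st 0%N ((s * nA + a) * nS + s')%N = rew M s a s' /\
        rmem st 1%N ((s * nA + a) * nS + s')%N = pbar M s a s',
      forall s : 'I_nS, rmem st 2%N s = v s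
    & [/\ rmem st 3%N 0%N = disc M, rmem st 4%N 0%N = budget M
        & rmem st 5%N 0%N = eps]].

Definition output (R : realType) (nS : nat) (st : state R) : 'I_nS -> R :=
  fun s => rmem st 6%N s.
Arguments output {R} nS st.

(* Main.v *)
Require Import Defs.
From mathcomp Require Import all_boot all_order all_algebra.
From mathcomp Require Import zify ring lra.
From mathcomp Require Import boolp classical_sets reals topology normedtype exp.

Set Implicit Arguments.
Unset Strict Implicit.
Unset Printing Implicit Defensive.

Import Order.TTheory GRing.Theory Num.Theory.
Import numFieldNormedType.Exports.
Local Open Scope ring_scope.

(* For a state s write b_a = r_sa + lambda v and let D_a(theta) be the least
   chi^2-distance to pbar_sa of a distribution p with p . b_a <= theta. Then
   [J(v)]_s is the least theta with sum_a D_a(theta) <= kappa: if the sum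
   exceeds kappa, the policy proportional to the multipliers of the constraints
   p . b_a <= theta guarantees at least theta. This theta is found by bisection
   on [0, max b]; since v <= vstar, the interval has length at most Rbar.
   The minimizer for D_a(theta) is p = q (mu - c b)_+ with q = pbar_sa, so once
   the pairs (b, q) are sorted by b (merge sort) its support is a prefix, and
   with u = b - theta one scan of the prefix sums Q, U, U2 of q, q u, q u^2
   finds this prefix and the value D_a(theta) = U2 / (U2 Q - U^2) - 1. *)

(** * Weakest preconditions with running time *)

Section ProgramLogic.
Variable R : realType.
Implicit Types (st : state R) (c : cmd) (Q : nat -> state R -> Prop).

(** Total correctness: some execution halts and the postcondition sees its running time, so that
    termination and cost are proved together. *)
Definition wp c st Q := exists t st', exec c st t st' /\ Q t st'.

Lemma wp_mono c st Q Q' :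
  wp c st Q -> (forall t st', Q t st' -> Q' t st') -> wp c st Q'.
Proof. by move=> [t [st' [he hq]]] h; exists t, st'; split=> //; apply: h. Qed.

Lemma wp_skip st Q : Q 1%N st -> wp Skip st Q.
Proof. by move=> h; exists 1%N, st; split=> //; constructor. Qed.

Lemma wp_iset st x e Q :
  Q (icost e).+1 (set_ireg st x (ieval st e)) -> wp (ISet x e) st Q.
Proof. by move=> h; do 2!eexists; split; [constructor | exact: h]. Qed.

Lemma wp_rset st b e r Q :
  Q (icost e + rcost r).+1 (set_rmem st b (ieval st e) (reval st r)) ->
  wp (RSet b e r) st Q.
Proof. by move=> h; do 2!eexists; split; [constructor | exact: h]. Qed.

Lemma wp_seq st c1 c2 Q :
  wp c1 st (fun t1 st1 => wp c2 st1 (fun t2 st2 => Q (t1 + t2)%N st2)) ->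
  wp (Seq c1 c2) st Q.
Proof.
move=> [t1 [st1 [h1 [t2 [st2 [h2 hQ]]]]]].
by exists (t1 + t2)%N, st2; split=> //; apply: ExecSeq h1 h2.
Qed.

Lemma wp_if st b c1 c2 Q :
  (if beval st b then wp c1 st (fun t st' => Q (bcost b + t).+1 st')
   else wp c2 st (fun t st' => Q (bcost b + t).+1 st')) ->
  wp (If b c1 c2) st Q.
Proof.
case: ifPn => hb [t [st' [he hq]]]; exists (bcost b + t).+1, st'; split=> //.
- exact: ExecIfTrue.
- exact: ExecIfFalse.
Qed.

(** [imods] and [rmods] over-approximate the registers and the whole banks that a command may write.
    Being read off the syntax, they give frame conditions by computation. *)
Fixpoint imods c : seq nat :=
  match c with
  | ISet x _ => [:: x]
  | Seq c1 c2 | If _ c1 c2 => imods c1 ++ imods c2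
  | While _ c1 => imods c1
  | _ => [::]
  end.

Fixpoint rmods c : seq nat :=
  match c with
  | RSet b _ _ => [:: b]
  | Seq c1 c2 | If _ c1 c2 => rmods c1 ++ rmods c2
  | While _ c1 => rmods c1
  | _ => [::]
  end.

Definition agree (xs bs : seq nat) st st' :=
  (forall x, x \notin xs -> ireg st' x = ireg st x) /\
  (forall b, b \notin bs -> forall i, rmem st' b i = rmem st b i).

Lemma agree_trans xs bs st1 st2 st3 :
  agree xs bs st1 st2 -> agree xs bs st2 st3 -> agree xs bs st1 st3.
Proof.
move=> [h1 h2] [h3 h4]; split=> [x hx|b hb i]; first by rewrite h3 ?h1.
by rewrite h4 ?h2.
Qed.

Lemma agree_sub xs bs xs' bs' st st' :
  {subset xs <= xs'} -> {subset bs <= bs'} ->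
  agree xs bs st st' -> agree xs' bs' st st'.
Proof.
move=> hx hb [h1 h2]; split=> [x xn|b bn i].
  by apply: h1; apply: contra xn; apply: hx.
by apply: h2; apply: contra bn; apply: hb.
Qed.

Lemma exec_agree c st t st' :
  exec c st t st' -> agree (imods c) (rmods c) st st'.
Proof.
elim=> {c st t st'} //=.
- move=> st x e; split=> //= y; rewrite inE => /negbTE hy.
  by rewrite hy.
- move=> st b e r; split=> //= b'; rewrite inE => /negbTE hb i.
  by rewrite hb.
- move=> c1 c2 st st1 st2 t1 t2 _ h1 _ h2.
  apply: agree_trans.
    by apply: agree_sub h1 => z hz; rewrite mem_cat hz.
  by apply: agree_sub h2 => z hz; rewrite mem_cat hz orbT.
- move=> b c1 c2 st st' t _ _ h.
  by apply: agree_sub h => z hz; rewrite mem_cat hz.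
- move=> b c1 c2 st st' t _ _ h.
  by apply: agree_sub h => z hz; rewrite mem_cat hz orbT.
- by move=> b c st st1 st2 t1 t2 _ _ h1 _ h2; apply: agree_trans h1 h2.
Qed.

Lemma wp_agree c st Q :
  wp c st Q ->
  wp c st (fun t st' => Q t st' /\ agree (imods c) (rmods c) st st').
Proof.
move=> [t [st' [he hq]]]; exists t, st'; split=> //; split=> //.
exact: exec_agree he.
Qed.

(* The first argument of the invariant [I] is an upper bound on the time that
   remains; since every iteration takes time, the rule also yields
   termination. *)
Lemma wp_while (I : nat -> state R -> Prop) b c m st :
  I m st ->
  (forall k st', agree (imods c) (rmods c) st st' -> I k st' ->
     if beval st' b then
       wp c st' (fun t st'' =>
         exists2 k', I k' st'' & ((bcost b + t).+1 + k' <= k)%N)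
     else (bcost b < k)%N) ->
  wp (While b c) st (fun t st' =>
    [/\ (t <= m)%N, agree (imods c) (rmods c) st st', ~~ beval st' b
      & exists k, I k st']).
Proof.
move=> hI0 hstep.
(* Induction on a strict bound [n] of the remaining time [m], which every iteration decreases. *)
suff: forall n st0, (m < n)%N -> agree (imods c) (rmods c) st st0 -> I m st0 ->
    wp (While b c) st0 (fun t st' =>
    [/\ (t <= m)%N, agree (imods c) (rmods c) st st', ~~ beval st' b
      & exists k, I k st']) by move/(_ m.+1 st (ltnSn m)); apply.
move=> n; elim: n m {hI0} => // n IHn m st0 lemn hag hI.
have := hstep _ _ hag hI; case: ifPn => hb.
- case=> t [st1 [he [m' hI' hm']]].
  have hag1 := agree_trans hag (exec_agree he).
  have ltm : (m' < n)%N by lia.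
  have [t2 [st2 [he2 [ht2 hag2 hb2 hI2]]]] := IHn m' st1 ltm hag1 hI'.
  exists (bcost b + t + t2).+1, st2; split; first exact: ExecWhileTrue he he2.
  by split=> //; lia.
- move=> hlt; exists (bcost b).+1, st0; split; first exact: ExecWhileFalse.
  by split=> //; exists m.
Qed.

Definition For (x : nat) (e : iexp) (c : cmd) : cmd :=
  Seq (ISet x (INum 0))
    (While (BILe (IAdd (IReg x) (INum 1)) e)
       (Seq c (ISet x (IAdd (IReg x) (INum 1))))).

(** The invariant speaks of the state after the increment of [x]. Besides the body, a round pays
    [icost e + 5] for the test and 4 for the increment. *)
Lemma wp_for (I : nat -> state R -> Prop) x e c n T st :
  x \notin imods c ->
  (forall st', agree (x :: imods c) (rmods c) st st' -> ieval st' e = n) ->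
  I 0%N (set_ireg st x 0) ->
  (forall k st', (k < n)%N -> agree (x :: imods c) (rmods c) st st' ->
     ireg st' x = k -> I k st' ->
     wp c st' (fun t st'' => (t <= T)%N /\ I k.+1 (set_ireg st'' x k.+1))) ->
  wp (For x e c) st (fun t st' =>
    [/\ (t <= n * (T + icost e + 9) + icost e + 9)%N,
      agree (x :: imods c) (rmods c) st st' & I n st']).
Proof.
move=> xc he I0 hstep; apply: wp_seq; apply: wp_iset.
set st0 := set_ireg _ _ _.
have ag0 : agree (x :: imods c) (rmods c) st st0.
  by split=> //= y; rewrite inE negb_or => /andP[/negbTE-> _].
pose J m st' := exists2 k, [/\ (k <= n)%N, ireg st' x = k & I k st']
   & m = ((n - k) * (T + icost e + 9) + icost e + 6)%N.
have J0 : J (n * (T + icost e + 9) + icost e + 6)%N st0.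
  by exists 0%N; rewrite ?subn0 //=; split=> //=; rewrite eqxx.
apply: wp_mono; first apply: (wp_while J0).
- move=> m st' ag' [k [lekn hk hI] ->] /=.
  have ag : agree (x :: imods c) (rmods c) st st'.
    apply: agree_trans ag0 _; apply: agree_sub ag' => z; rewrite /= ?cats0 //.
    by rewrite mem_cat !inE orbC.
  rewrite (he _ ag) hk addn1; case: ifPn => hb; last by lia.
  apply: wp_seq; apply: wp_mono; first exact: wp_agree (hstep _ _ hb ag hk hI).
  move=> t st1 [[ht hI1] ag1]; apply: wp_iset => /=.
  rewrite ag1.1 // hk addn1.
  exists ((n - k.+1) * (T + icost e + 9) + icost e + 6)%N.
    by exists k.+1 => //; split=> //=; rewrite eqxx.
  rewrite -(subnSK hb) mulSn; lia.
- move=> t st' [ht ag' nb [m [k [lekn hk hI] _]]].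
  have ag : agree (x :: imods c) (rmods c) st st'.
    apply: agree_trans ag0 _; apply: agree_sub ag' => z; rewrite /= ?cats0 //.
    by rewrite mem_cat !inE orbC.
  split=> //; first by move: ht => /=; lia.
  move: nb => /=; rewrite (he _ ag) hk -ltnNge addn1 ltnS => len.
  by have -> : n = k by lia.
Qed.

End ProgramLogic.

Ltac vcg := repeat lazymatch goal with
  | |- wp (Seq _ _) _ _ => apply: wp_seq
  | |- wp (ISet _ _) _ _ => apply: wp_iset
  | |- wp (RSet _ _ _) _ _ => apply: wp_rset
  | |- wp Skip _ _ => apply: wp_skip
  | |- wp (If _ _ _) _ _ => apply: wp_if
  end.

(** * Duality *)

Section Chi2.
Variable R : realType.

Definition payoff nS nA (M : rmdp R nS nA) (v : 'I_nS -> R) s a s' : R :=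
  rew M s a s' + disc M * v s'.

Lemma divergenceE n (p q : 'I_n -> R) :
  simplex R n p -> simplex R n q -> (forall i, 0 < q i) ->
  divergence p q = \sum_(i < n) p i ^+ 2 / q i - 1.
Proof.
move=> [_ p1] [_ q1] q0.
(* Writing 1 in this way reduces the claim to an identity between single summands. *)
have -> : 1 = 2 * \sum_(i < n) p i - \sum_(i < n) q i :> R by rewrite p1 q1; ring.
rewrite mulr_sumr -!sumrB; apply: eq_bigr => i _; rewrite /phi.
by field; rewrite gt_eqF.
Qed.

Lemma divergence_ge0 n (p q : 'I_n -> R) :
  (forall i, 0 < q i) -> 0 <= divergence p q.
Proof.
by move=> q0; apply: sumr_ge0 => i _; rewrite mulr_ge0 ?sqr_ge0 // ltW.
Qed.

Lemma divergence_refl n (q : 'I_n -> R) :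
  (forall i, 0 < q i) -> divergence q q = 0.
Proof.
move=> q0; apply: big1 => i _; rewrite /phi divff ?gt_eqF //.
by rewrite subrr expr0n mulr0.
Qed.

(* Optimality conditions for minimizing [divergence p q] over the
   distributions [p] with [p . b <= theta]: [mu] and [c] are the multipliers,
   the minimizer is [p = q (mu - c b)_+] and [D] is the minimum. The list
   [L] holds the pairs [(b i, q i)]. *)
Definition kkt (L : seq (R * R)) (theta D : R) :=
  exists mu c, let z x := Num.max 0 (mu - c * x) in
  [/\ 0 <= c, \sum_(x <- L) x.2 * z x.1 = 1,
      \sum_(x <- L) x.2 * z x.1 * x.1 <= theta,
      \sum_(x <- L) x.2 * z x.1 ^+ 2 = D + 1
    & mu - c * theta = D + 1].

Definition pairs n (b q : 'I_n -> R) := [seq (b i, q i) | i <- enum 'I_n].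

Lemma big_pairs n (b q : 'I_n -> R) (F : R * R -> R) :
  \sum_(x <- pairs b q) F x = \sum_(i < n) F (b i, q i).
Proof. by rewrite big_map big_enum. Qed.

Lemma kkt_perm L L' theta D : perm_eq L L' -> kkt L theta D -> kkt L' theta D.
Proof.
move=> LL' [mu [c [c0 h1 h2 h3 h4]]]; exists mu, c.
by rewrite /= -!(perm_big _ LL').
Qed.

(** The multipliers give the minimizer explicitly: [p = q (mu - c b)_+] is feasible and attains
    [D]. *)
Lemma kkt_primal n (b q : 'I_n -> R) theta D :
  simplex R n q -> (forall i, 0 < q i) -> kkt (pairs b q) theta D ->
  exists p, [/\ simplex R n p, \sum_(i < n) p i * b i <= theta
    & divergence p q = D].
Proof.
move=> qs q0 [mu [c]] /=; rewrite !big_pairs /= => -[c0 h1 h2 h3 h4].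
pose p i := q i * Num.max 0 (mu - c * b i); exists p.
have ps : simplex R n p.
  by split=> // i; rewrite mulr_ge0 // ?(ltW (q0 i)) // le_max lexx.
split=> //; rewrite divergenceE //; apply/eqP; rewrite subr_eq -h3; apply/eqP.
by apply: eq_bigr => i _; rewrite /p; field; rewrite gt_eqF.
Qed.

(** Lagrangian bound with multiplier [2 * c]: expand [(p - q z)^2 / q >= 0], bound [z] below by
    [mu - c b], and eliminate [mu] by the last condition of [kkt]. *)
Lemma kkt_dual n (b q : 'I_n -> R) theta D :
  simplex R n q -> (forall i, 0 < q i) -> kkt (pairs b q) theta D ->
  exists2 c, 0 <= c & forall p, simplex R n p ->
    D - 2 * c * (\sum_(i < n) p i * b i - theta) <= divergence p q.
Proof.
move=> qs q0 [mu [c]] /=; rewrite !big_pairs /= => -[c0 h1 h2 h3 h4].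
exists c => // p ps; rewrite divergenceE //.
set z := fun i => Num.max 0 (mu - c * b i).
have : \sum_(i < n) (2 * (mu * p i - c * (p i * b i)) - q i * z i ^+ 2)
       <= \sum_(i < n) p i ^+ 2 / q i.
  apply: ler_sum => i _; have qi := q0 i.
  have : 0 <= (p i - q i * z i) ^+ 2 / q i by rewrite mulr_ge0 ?sqr_ge0 // invr_ge0 ltW.
  have -> : (p i - q i * z i) ^+ 2 / q i =
     p i ^+ 2 / q i - 2 * (p i * z i) + q i * z i ^+ 2.
    by field; rewrite gt_eqF.
  have : p i * (mu - c * b i) <= p i * z i.
    by rewrite ler_wpM2l ?(ps.1 i) // le_max lexx orbT.
  lra.
rewrite sumrB h3 -mulr_sumr sumrB -!mulr_sumr ps.2; lra.
Qed.

End Chi2.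

(** * The minimizer from prefix sums of the sorted data *)

Section Scan.
Variable R : realType.
Variables (n k : nat) (b q : nat -> R) (theta : R).

(* The prefix of length [k] of the sorted data is the support of the
   minimizer. *)
Lemma kkt_prefix (u := fun i => b i - theta)
    (Q := \sum_(0 <= i < k) q i) (U := \sum_(0 <= i < k) q i * u i)
    (U2 := \sum_(0 <= i < k) q i * u i ^+ 2) :
  (forall i j, (i <= j < n)%N -> b i <= b j) ->
  (forall i, (i < n)%N -> 0 < q i) -> \sum_(0 <= i < n) q i = 1 ->
  b 0%N < theta -> (0 < k <= n)%N -> u k.-1 * U <= U2 ->
  ((k < n)%N -> U2 < u k * U) ->
  kkt (mkseq (fun i => (b i, q i)) n) theta
      (if U <= 0 then 0 else U2 / (U2 * Q - U ^+ 2) - 1).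
Proof.
move=> bs q0 q1 bt /andP[k0 kn] hlast hnext.
have sumE (F : R * R -> R) : \sum_(x <- mkseq (fun i => (b i, q i)) n) F x =
    \sum_(0 <= i < n) F (b i, q i).
  by rewrite big_map /index_iota subn0.
case: ifPn => [U0|]; last rewrite -ltNge => Up.
(* For [U <= 0] the scan cannot stop early, since [u k.-1 * U <= U2 < u k * U] with [u k.-1 <= u k]
   forces [U > 0]. Then [q] itself meets the constraint, and [mu = 1], [c = 0] give [D = 0]. *)
- have kE : k = n.
    apply/eqP; rewrite eqn_leq kn leqNgt; apply/negP => ltkn.
    have := hnext ltkn; have : u k.-1 <= u k.
      by rewrite lerB // bs //; lia.
    move: hlast U0; move: (u k) (u k.-1) => x y; nra.
  have z1 x : Num.max 0 (1 - 0 * x) = 1 :> R.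
    by rewrite mul0r subr0; apply/max_idPr.
  exists 1, 0; rewrite /= !sumE /=; split; rewrite ?mul0r ?subr0 ?add0r //.
  - by rewrite -[RHS]q1; apply: eq_bigr => i _; rewrite z1 mulr1.
  - under eq_bigr do rewrite z1 mulr1.
    move: U0; rewrite /U kE /u /=; under eq_bigr do rewrite mulrBr.
    by rewrite sumrB -mulr_suml q1 mul1r subr_le0.
  - by rewrite -[RHS]q1; apply: eq_bigr => i _; rewrite z1 expr1n mulr1.
have upk i : (i < k)%N -> u i * U <= U2.
  move=> ik; apply: le_trans hlast; rewrite ler_pM2r // lerB // bs //; lia.
have U2p : 0 < U2.
  have -> : U2 = \sum_(0 <= i < k) q i * u i ^+ 2 by [].
  rewrite big_ltn //; apply: ltr_pwDl.
    rewrite mulr_gt0 ?q0 ?(leq_trans k0) // exprn_even_gt0 //= /u; lra.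
  rewrite big_nat_cond; apply: sumr_ge0 => i /andP[/andP[_ ik] _].
  by rewrite mulr_ge0 ?sqr_ge0 // ltW // q0; lia.
(* The denominator is a sum of terms [q i * (U2 - u i * U)], which are nonnegative on the prefix;
   the first is positive because [u 0 < 0 < U]. *)
set W := U2 * Q - U ^+ 2.
have WE : W = \sum_(0 <= i < k) q i * (U2 - u i * U).
  under eq_bigr do rewrite mulrBr [q _ * (u _ * _)]mulrA.
  by rewrite sumrB -!mulr_suml -/Q -/U /W; ring.
have Wp : 0 < W.
  rewrite WE big_ltn //; apply: ltr_pwDl.
    rewrite mulr_gt0 ?q0 ?(leq_trans k0) // subr_gt0.
    by apply: lt_trans U2p; rewrite pmulr_llt0 // subr_lt0.
  rewrite big_nat_cond; apply: sumr_ge0 => i /andP[/andP[_ ik] _].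
  by rewrite mulr_ge0 ?subr_ge0 ?upk // ltW // q0; lia.
have W0 : W != 0 by rewrite gt_eqF.
(* These solve the linear system saying that, on the prefix, [q z] has total mass 1 and [q z u] sums
   to 0, for [z = mu - c b]. *)
pose c := U / W; pose mu := c * theta + U2 / W.
have zE i : mu - c * b i = (U2 - u i * U) / W by rewrite /mu /c /u; field.
have zin i : (i < k)%N -> Num.max 0 (mu - c * b i) = (U2 - u i * U) / W.
  move=> ik; rewrite zE; apply/max_idPr.
  by rewrite mulr_ge0 ?subr_ge0 ?upk // invr_ge0 ltW.
(* The test that failed at [k] fails at all later entries too, as [u] is monotone and [U > 0]. *)
have zout i : (k <= i < n)%N -> Num.max 0 (mu - c * b i) = 0.
  move=> /andP[ki ltin]; rewrite zE; apply/max_idPl.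
  rewrite pmulr_lle0 ?invr_gt0 // subr_le0.
  apply: le_trans (ltW (hnext (leq_ltn_trans ki ltin))) _.
  by rewrite ler_pM2r // lerB // bs // ki.
have sumk (F G : nat -> R) : (forall i, (k <= i < n)%N -> F i = 0) ->
    (forall i, (i < k)%N -> F i = G i) ->
    \sum_(0 <= i < n) F i = \sum_(0 <= i < k) G i.
  move=> F0 FG; rewrite (big_cat_nat _ kn) //=.
  rewrite [X in _ + X]big1_seq ?addr0; last first.
    by move=> i; rewrite mem_index_iota => /F0.
  by apply: eq_big_nat => i /FG.
exists mu, c; rewrite /= !sumE /= subrK; split.
- by rewrite divr_ge0 ?ltW.
- rewrite (sumk _ (fun i => q i * (U2 - u i * U) / W)).
  + by rewrite -mulr_suml -WE divff.
  + by move=> i /zout ->; rewrite mulr0.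
  + by move=> i /zin ->; rewrite mulrA.
(* Split [b = theta + u]: the first part sums to [theta], the second to 0, so the constraint is
   tight. *)
- rewrite (sumk _ (fun i => theta * (q i * (U2 - u i * U) / W) +
     (q i * u i * U2 - q i * u i ^+ 2 * U) / W)).
  + rewrite big_split /= -mulr_sumr -!mulr_suml -WE divff // sumrB -!mulr_suml.
    by rewrite -/U -/U2 [U * _]mulrC subrr mul0r mulr1 addr0.
  + by move=> i /zout ->; rewrite mulr0 mul0r.
  + by move=> i /zin ->; rewrite /u; ring.
(* One factor [z] is replaced by [(U2 - u * U) / W]; the two equations solved above leave
   [U2 / W]. *)
- rewrite (sumk _ (fun i => (U2 * (q i * (U2 - u i * U)) -
     U * (q i * u i * U2 - q i * u i ^+ 2 * U)) / W ^+ 2)).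
  + rewrite -mulr_suml sumrB -!mulr_sumr -WE sumrB -!mulr_suml -/U -/U2.
    by field.
  + by move=> i /zout ->; rewrite expr0n mulr0.
  + by move=> i /zin ->; field.
- by rewrite /mu addrAC subrr add0r.
Qed.

End Scan.

(** * Bounds on the Bellman value from the projections of all actions *)

Section Duality.
Variables (R : realType) (nS nA : nat) (M : rmdp R nS nA).
Variable v : 'I_nS -> R.
Hypothesis nA_gt0 : (0 < nA)%N.
Hypothesis payoff_ge0 : forall s a s', 0 <= payoff M v s a s'.

Local Open Scope classical_set_scope.

Lemma simplex_vertex n (i0 : 'I_n) : simplex R n (fun i => (i == i0)%:R).
Proof.
split=> [i|]; first exact: ler0n.
by rewrite (bigD1 i0) //= eqxx big1 ?addr0 // => i /negbTE ->.
Qed.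

Lemma expected_value_vertex s a0 p :
  expected_value M v s (fun a => (a == a0)%:R) p =
  \sum_(s' < nS) p a0 s' * payoff M v s a0 s'.
Proof.
rewrite /expected_value (bigD1 a0) //= eqxx mul1r.
by rewrite [X in _ + X]big1 ?addr0 // => a /negbTE ->; rewrite mul0r.
Qed.

Lemma ambiguity_pbar s : ambiguity M s (pbar M s).
Proof.
split=> [a|]; first exact: pbar_simplex.
rewrite big1 ?(ltW (budget_gt0 M)) // => a _.
by apply: divergence_refl => i; apply: pbar_gt0.
Qed.

Lemma simplex_mean_ge n (p f : 'I_n -> R) x :
  simplex R n p -> (forall i, x <= f i) -> x <= \sum_i p i * f i.
Proof.
move=> [p0 p1] hf; rewrite -[x]mul1r -p1 mulr_suml.
by apply: ler_sum => i _; rewrite ler_wpM2l.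
Qed.

Lemma simplex_mean_le n (p f : 'I_n -> R) x :
  simplex R n p -> (forall i, f i <= x) -> \sum_i p i * f i <= x.
Proof.
move=> [p0 p1] hf; rewrite -[x]mul1r -p1 mulr_suml.
by apply: ler_sum => i _; rewrite ler_wpM2l.
Qed.

(** Nonnegative payoffs bound the set below by 0, so that [inf] is a true infimum and not a default
    value. *)
Lemma inf_expected_value_le s pi p : simplex R nA pi -> ambiguity M s p ->
  inf [set expected_value M v s pi p | p in ambiguity M s] <=
  expected_value M v s pi p.
Proof.
move=> pis hp; apply: ge_inf; last by exists p.
exists 0 => _ [p' [hp' _] <-].
exact: (simplex_mean_ge pis (fun a => simplex_mean_ge (hp' a) (payoff_ge0 s a))).
Qed.

(** A single kernel [p] that is good against every action is good against every policy, as a policy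
    only averages over actions. *)
Lemma bellman_le s p theta : ambiguity M s p ->
  (forall a, \sum_(s' < nS) p a s' * payoff M v s a s' <= theta) ->
  bellman M v s <= theta.
Proof.
move=> hp hle; apply: ge_sup.
  by eexists; apply: imageP (simplex_vertex (Ordinal nA_gt0)).
move=> _ [pi pis <-]; apply: le_trans (inf_expected_value_le pis hp) _.
exact: simplex_mean_le pis hle.
Qed.

Lemma bellman_ge s pi theta : simplex R nA pi ->
  (forall p, ambiguity M s p -> theta <= expected_value M v s pi p) ->
  theta <= bellman M v s.
Proof.
move=> pis hge; apply: le_trans (ub_le_sup _ _); last by exists pi; first exact: pis.
  apply: lb_le_inf; first by eexists; apply: imageP (ambiguity_pbar s).
  by move=> _ [p hp <-]; apply: hge.
(* The sum of all payoffs is a crude upper bound, which makes [sup] a true supremum. *)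
exists (\sum_a \sum_s' payoff M v s a s') => _ [pi' pis' <-].
apply: le_trans (inf_expected_value_le pis' (ambiguity_pbar s)) _.
apply: simplex_mean_le => // a; apply: simplex_mean_le => [|s'].
  exact: pbar_simplex.
rewrite (bigD1 a) //= (bigD1 s') //= -addrA lerDl addr_ge0 //.
  by apply: sumr_ge0.
by apply: sumr_ge0 => ? _; apply: sumr_ge0.
Qed.

Lemma bellman_ge0 s : 0 <= bellman M v s.
Proof.
apply: (bellman_ge (simplex_vertex (Ordinal nA_gt0))) => p [ps _].
by rewrite expected_value_vertex; apply: simplex_mean_ge.
Qed.

Lemma bellman_le_max s x :
  (forall a s', payoff M v s a s' <= x) -> bellman M v s <= x.
Proof.
move=> hx; apply: (bellman_le (ambiguity_pbar s)) => a.
by apply: simplex_mean_le => //; apply: pbar_simplex.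
Qed.

(* In the second case the minimal divergence may be infinite, and any value
   above the budget can stand for it. *)
Definition projects s a theta D :=
  kkt (pairs (payoff M v s a) (pbar M s a)) theta D \/
  (budget M < D /\ forall s', theta <= payoff M v s a s').

Variables (s : 'I_nS) (theta : R) (D : 'I_nA -> R).
Hypothesis DP : forall a, projects s a theta (D a).

Lemma projects_ge0 a : 0 <= D a.
Proof.
case: (DP a) => [|[h _]]; last exact: ltW (lt_trans (budget_gt0 M) h).
case/kkt_primal => [||p [_ _ <-]]; first exact: pbar_simplex.
  by move=> i; apply: pbar_gt0.
by apply: divergence_ge0 => i; apply: pbar_gt0.
Qed.

(** All [D a] are nonnegative, so none exceeds the budget and each comes from a minimizer; together
    the minimizers form an admissible kernel. *)
Lemma bellman_le_of_projects : \sum_a D a <= budget M -> bellman M v s <= theta.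
Proof.
move=> hsum.
have hk a : kkt (pairs (payoff M v s a) (pbar M s a)) theta (D a).
  case: (DP a) => // -[hD _]; suff : D a <= budget M by rewrite leNgt hD.
  apply: le_trans hsum; rewrite (bigD1 a) //= lerDl.
  by apply: sumr_ge0 => ? _; apply: projects_ge0.
have /fin_all_exists[p hp] : forall a, exists p,
    [/\ simplex R nS p, \sum_s' p s' * payoff M v s a s' <= theta
      & divergence p (pbar M s a) = D a].
  move=> a; apply: kkt_primal (hk a); first exact: pbar_simplex.
  by move=> i; apply: pbar_gt0.
apply: (@bellman_le s p) => [|a]; last by case: (hp a).
split=> [a|]; first by case: (hp a).
by rewrite (eq_bigr D) // => a _; case: (hp a).
Qed.

(* The policy is proportional to the multipliers of the constraints
   [p a . payoff a <= theta]. *)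
Lemma bellman_ge_of_projects : budget M < \sum_a D a -> theta <= bellman M v s.
Proof.
move=> hsum.
(* An action whose payoffs are all at least [theta] can simply be played. Without such an action,
   every [D a] carries multipliers. *)
have [/existsP[a /forallP ha]|/existsPn hn] :=
  boolP [exists a, [forall s', theta <= payoff M v s a s']].
  apply: (bellman_ge (simplex_vertex a)) => p [ps _].
  by rewrite expected_value_vertex; apply: simplex_mean_ge.
have hk a : kkt (pairs (payoff M v s a) (pbar M s a)) theta (D a).
  by case: (DP a) => // -[_ h]; case/negP: (hn a); apply/forallP.
have /fin_all_exists[c hc] : forall a, exists c, 0 <= c /\ forall p, simplex R nS p ->
    D a - 2 * c * (\sum_s' p s' * payoff M v s a s' - theta) <=
    divergence p (pbar M s a).
  move=> a; have [||c c0 h] := kkt_dual _ _ (hk a).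
  - exact: pbar_simplex.
  - by move=> i; apply: pbar_gt0.
  by exists c.
pose C := \sum_a c a.
(* Sum the dual bounds over the actions: the divergences total at most the budget, the [D a]
   more. *)
have key p : ambiguity M s p ->
    C * theta < \sum_a c a * \sum_s' p a s' * payoff M v s a s'.
  move=> [ps pk].
  have h a : D a <= divergence (p a) (pbar M s a) +
      2 * (c a * (\sum_s' p a s' * payoff M v s a s') - c a * theta).
    by have := (hc a).2 _ (ps a); lra.
  have := lt_le_trans hsum (ler_sum _ (fun a _ => h a)).
  rewrite big_split /= -mulr_sumr sumrB -mulr_suml -/C.
  by move: pk; lra.
have C0 : 0 <= C by apply: sumr_ge0 => a _; case: (hc a).
(* If [C] were 0, all multipliers would vanish, and [key] at the nominal kernel would read
   [0 < 0]. *)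
have Cp : 0 < C.
  rewrite lt_neqAle C0 andbT eq_sym; apply/eqP => C00.
  have := key _ (ambiguity_pbar s); rewrite C00 mul0r big1 ?ltxx // => a _.
  have /psumr_eq0P : \sum_a c a = 0 by [].
  by move=> /(_ (fun a _ => (hc a).1)) ->; rewrite ?mul0r.
apply: (@bellman_ge s (fun a => c a / C)) => [|p /key hp].
  split=> [a|]; first by rewrite divr_ge0 //; case: (hc a).
  by rewrite -mulr_suml divff // gt_eqF.
rewrite /expected_value; under eq_bigr do rewrite mulrAC.
by rewrite -mulr_suml ler_pdivlMr // mulrC; apply: ltW.
Qed.

End Duality.

(** * The bound on the value function *)

Section ValueBound.
Variables (R : realType) (nS nA : nat) (M : rmdp R nS nA).

(** [Rbar M] solves [x = m + disc M * x] for the maximal reward [m]. *)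
Lemma Rbar_fixpoint s a s' : rew M s a s' + disc M * Rbar M <= Rbar M.
Proof.
have d1 := disc_lt1 M; pose m := \big[Num.max/0]_s \big[Num.max/0]_a
  \big[Num.max/0]_s' rew M s a s'.
have hm : rew M s a s' <= m.
  apply: le_trans (le_bigmax _ _ s); apply: le_trans (le_bigmax _ _ a).
  exact: (le_bigmax _ (rew M s a) s').
have RE : Rbar M = m + disc M * Rbar M.
  by rewrite {1 2}/Rbar -/m; field; rewrite gt_eqF // subr_gt0.
by rewrite [leRHS]RE lerD2r.
Qed.

Lemma Rbar_ge0 : 0 <= Rbar M.
Proof.
rewrite mulr_ge0 ?invr_ge0 ?subr_ge0 ?(ltW (disc_lt1 M)) //.
exact: bigmax_ge_id.
Qed.

(** By [Rbar_fixpoint] the operator keeps the iterates from 0 between 0 and [Rbar M]; the bound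
    passes to the limit. *)
Lemma vstar_le_Rbar (nA_gt0 : (0 < nA)%N) s : vstar M s <= Rbar M.
Proof.
have d0 := ltW (disc_gt0 M).
have bnd t s1 : 0 <= iter t (bellman M) (fun=> 0) s1 <= Rbar M.
  elim: t s1 => [|t IHt] s1 /=; first by rewrite lexx Rbar_ge0.
  have p0 s2 a s' : 0 <= payoff M (iter t (bellman M) (fun=> 0)) s2 a s'.
    by rewrite addr_ge0 ?rew_ge0 // mulr_ge0 //; case/andP: (IHt s').
  rewrite bellman_ge0 //=; apply: bellman_le_max => // a s'.
  apply: le_trans (Rbar_fixpoint s1 a s').
  by rewrite lerD2l ler_wpM2l //; case/andP: (IHt s').
(* A divergent sequence has the default limit 0, so both cases yield the bound. *)
rewrite /vstar; have [hc|/dvgP ->] := pselect (cvgn (fun t => iter t (bellman M) (fun=> 0) s)).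
  by apply: limr_le => //; near=> t; case/andP: (bnd t s).
exact: Rbar_ge0.
Unshelve. all: by end_near. Qed.

End ValueBound.

(** * Merge sort *)

(* Registers: 0 = nS, 1 = nA, 2 = state, 3 = action, 4 = successor state,
   5 = width of the sorted blocks, 6, 7, 8 = ends of the two blocks being
   merged, 9, 10 = reading positions, 11 = writing or scanning position.
   Real banks: 7, 8 = payoffs and nominal probabilities of the current action,
   9, 10 = target of the merge. *)
Definition merge_step : cmd :=
  Seq (If (BAnd (BILe (IAdd (IReg 9) (INum 1)) (IReg 7))
            (BNot (BAnd (BILe (IAdd (IReg 10) (INum 1)) (IReg 8))
               (BNot (BRLe (RMem 7 (IReg 9)) (RMem 7 (IReg 10)))))))
        (Seq (RSet 9 (IReg 11) (RMem 7 (IReg 9)))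
          (Seq (RSet 10 (IReg 11) (RMem 8 (IReg 9)))
             (ISet 9 (IAdd (IReg 9) (INum 1)))))
        (Seq (RSet 9 (IReg 11) (RMem 7 (IReg 10)))
          (Seq (RSet 10 (IReg 11) (RMem 8 (IReg 10)))
             (ISet 10 (IAdd (IReg 10) (INum 1))))))
    (ISet 11 (IAdd (IReg 11) (INum 1))).

Definition merge_blocks : cmd :=
  Seq (ISet 9 (IReg 6)) (Seq (ISet 10 (IReg 7)) (Seq (ISet 11 (IReg 6))
    (While (BILe (IAdd (IReg 11) (INum 1)) (IReg 8)) merge_step))).

(* [nS - (nS - x)] is the minimum of [x] and [nS]. *)
Definition merge_pass : cmd :=
  Seq (ISet 6 (INum 0))
    (While (BILe (IAdd (IReg 6) (INum 1)) (IReg 0))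
      (Seq (ISet 7 (ISub (IReg 0) (ISub (IReg 0) (IAdd (IReg 6) (IReg 5)))))
      (Seq (ISet 8 (ISub (IReg 0) (ISub (IReg 0)
              (IAdd (IReg 6) (IAdd (IReg 5) (IReg 5))))))
      (Seq merge_blocks (ISet 6 (IReg 8)))))).

Definition copy_back : cmd :=
  For 4 (IReg 0) (Seq (RSet 7 (IReg 4) (RMem 9 (IReg 4)))
                      (RSet 8 (IReg 4) (RMem 10 (IReg 4)))).

(** The bottom-up variant, as commands have no recursion: the block width doubles with every
    pass. *)
Definition merge_sort : cmd :=
  Seq (ISet 5 (INum 1))
    (While (BILe (IAdd (IReg 5) (INum 1)) (IReg 0))
      (Seq merge_pass (Seq copy_back (ISet 5 (IAdd (IReg 5) (IReg 5)))))).

Section MergeSort.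
Variable R : realType.
Implicit Types (st : state R) (F G : nat -> R * R) (P : pred (R * R)).

Definition src st l := (rmem st 7 l, rmem st 8 l).
Definition dst st l := (rmem st 9 l, rmem st 10 l).

Definition sorted_on F lo hi := forall i j, (lo <= i <= j)%N -> (j < hi)%N ->
  (F i).1 <= (F j).1.

(** Equal counts for all [P] express that two arrays are permutations of each other, and counts add
    up over adjacent index ranges, which suits loop invariants. *)
Definition occ F P lo hi := (\sum_(lo <= l < hi) P (F l))%N.

Lemma occ_recr F P lo hi : (lo <= hi)%N ->
  occ F P lo hi.+1 = (occ F P lo hi + P (F hi))%N.
Proof. by move=> h; rewrite /occ big_nat_recr. Qed.

Lemma occ_cat F P lo mid hi : (lo <= mid <= hi)%N ->
  occ F P lo hi = (occ F P lo mid + occ F P mid hi)%N.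
Proof. by case/andP=> h1 h2; rewrite /occ (big_cat_nat h1 h2). Qed.

Lemma occ_geq F P lo hi : (hi <= lo)%N -> occ F P lo hi = 0%N.
Proof. exact: big_geq. Qed.

Lemma eq_occ F G P lo hi : (forall l, (lo <= l < hi)%N -> F l = G l) ->
  occ F P lo hi = occ G P lo hi.
Proof. by move=> h; apply: eq_big_nat => l /h ->. Qed.

(** Loop invariant of the merge: [i] and [j] are the reading positions in the two blocks of [F], and
    the output written to [G] so far is sorted and below everything unread. *)
Record merging F G lo mid hi i j k := Merging {
  merging_i : (lo <= i <= mid)%N;
  merging_j : (mid <= j <= hi)%N;
  merging_k : k = (i + (j - mid))%N;
  merging_sorted : sorted_on G lo k;
  merging_le : forall l l', (lo <= l < k)%N ->
    (i <= l' < mid)%N || (j <= l' < hi)%N -> (G l).1 <= (F l').1;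
  merging_occ : forall P, occ G P lo k = (occ F P lo i + occ F P mid j)%N }.

Lemma merging_start F G lo mid hi : (lo <= mid <= hi)%N ->
  merging F G lo mid hi lo mid lo.
Proof.
case/andP=> lm mh; split; rewrite ?lm ?leqnn //; first by rewrite subnn addn0.
- by move=> i j; lia.
- by move=> l l'; lia.
- by move=> P; rewrite !occ_geq.
Qed.

Lemma sorted_on_extend F G lo k : sorted_on G lo k ->
  (forall l, l != k -> F l = G l) ->
  (forall l, (lo <= l < k)%N -> (G l).1 <= (F k).1) -> sorted_on F lo k.+1.
Proof.
move=> hs FG hk l l' /andP[lol ll'] l'k.
have [l'E|l'n] := eqVneq l' k.
  rewrite l'E; have [->//|ln] := eqVneq l k.
  by rewrite FG // hk // lol; lia.
by rewrite !FG ?hs ?lol //; lia.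
Qed.

(** The entry at [i] is least among all unread ones: its own block is sorted, and it does not exceed
    the head of the other block. *)
Lemma merging_left F G G' lo mid hi i j k : sorted_on F lo mid ->
  sorted_on F mid hi -> merging F G lo mid hi i j k -> (i < mid)%N ->
  ((j < hi)%N -> (F i).1 <= (F j).1) -> G' k = F i ->
  (forall l, l != k -> G' l = G l) -> merging F G' lo mid hi i.+1 j k.+1.
Proof.
move=> s1 s2 [hi1 hj hk hs hle ho] im hij Gk Gl; split; try lia.
- apply: sorted_on_extend hs Gl _ => l hl; rewrite Gk hle //; lia.
- move=> l l' hl hl'; have [->|ln] := eqVneq l k; last by rewrite Gl ?hle //; lia.
  rewrite Gk; case/orP: hl' => hl'; first by apply: s1; lia.
  by apply: le_trans (hij _) _; [lia | apply: s2; lia].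
- move=> P; rewrite occ_recr; last by lia.
  rewrite Gk (eq_occ (G := G)) ?ho ?occ_recr; try lia.
  by move=> l hl; apply: Gl; lia.
Qed.

Lemma merging_right F G G' lo mid hi i j k : sorted_on F lo mid ->
  sorted_on F mid hi -> merging F G lo mid hi i j k -> (j < hi)%N ->
  ((i < mid)%N -> (F j).1 <= (F i).1) -> G' k = F j ->
  (forall l, l != k -> G' l = G l) -> merging F G' lo mid hi i j.+1 k.+1.
Proof.
move=> s1 s2 [hi1 hj hk hs hle ho] jh hij Gk Gl; split; try lia.
- apply: sorted_on_extend hs Gl _ => l hl; rewrite Gk hle //; lia.
- move=> l l' hl hl'; have [->|ln] := eqVneq l k; last by rewrite Gl ?hle //; lia.
  rewrite Gk; case/orP: hl' => hl'; last by apply: s2; lia.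
  by apply: le_trans (hij _) _; [lia | apply: s1; lia].
- move=> P; rewrite occ_recr; last by lia.
  rewrite Gk (eq_occ (G := G)) ?ho ?occ_recr; try lia.
  by move=> l hl; apply: Gl; lia.
Qed.

Lemma wp_merge_blocks st lo mid hi :
  ireg st 6 = lo -> ireg st 7 = mid -> ireg st 8 = hi ->
  (lo <= mid <= hi)%N -> sorted_on (src st) lo mid -> sorted_on (src st) mid hi ->
  wp merge_blocks st (fun t st' =>
    [/\ (t <= 50 * (hi - lo) + 20)%N, sorted_on (dst st') lo hi,
      forall P, occ (dst st') P lo hi = occ (src st) P lo hi
    & forall l, (l < lo)%N -> dst st' l = dst st l]).
Proof.
move=> e6 e7 e8 lmh slo shi; rewrite /merge_blocks; vcg.
set st0 := set_ireg _ _ _.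
pose I m st1 := exists i j k,
  [/\ [/\ ireg st1 9 = i, ireg st1 10 = j & ireg st1 11 = k],
     m = (50 * (hi - k) + 6)%N,
     merging (src st) (dst st1) lo mid hi i j k
   & forall l, (l < lo)%N -> dst st1 l = dst st l].
have I0 : I (50 * (hi - lo) + 6)%N st0.
  by exists lo, mid, lo; split=> //; apply: merging_start.
apply: wp_mono; first apply: (wp_while I0).
- move=> m st1 ag [i [j [k [[ei ej ek] -> hm hout]]]].
  have es l : (rmem st 7 l = rmem st1 7 l) * (rmem st 8 l = rmem st1 8 l).
    by rewrite !ag.2.
  have e7' : ireg st1 7 = mid by rewrite ag.1.
  have e8' : ireg st1 8 = hi by rewrite ag.1.
  rewrite /= ek e8' addn1; case: ifPn => ltk; last by lia.
  have [hi1 hj1 hk1 _ _ _] := hm.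
  rewrite /merge_step; vcg; rewrite /= ei ej e7' e8' !addn1.
  case: ifPn => hc; vcg; rewrite /= ?ei ?ej ?ek ?addn1.
  + set st2 := set_ireg _ _ _; exists (50 * (hi - k.+1) + 6)%N; last by lia.
    exists i.+1, j, k.+1; split=> //.
      apply: merging_left hm _ _ _ _ => //; first by lia.
      * by move=> jh; case/andP: hc => _; rewrite jh /= negbK /src /= !es.
      * by rewrite /dst /src /= eqxx !es.
      * by move=> l /negbTE ln; rewrite /dst /= ln.
    move=> l hl; rewrite -hout // /dst /=; have -> : l == k = false by lia.
    by [].
  + set st2 := set_ireg _ _ _; exists (50 * (hi - k.+1) + 6)%N; last by lia.
    exists i, j.+1, k.+1; split=> //.
      apply: merging_right hm _ _ _ _ => //; first by lia.
      * move=> him; move: hc; rewrite him /= negbK => /andP[_].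
        by rewrite /src /= !es -ltNge; apply: ltW.
      * by rewrite /dst /src /= eqxx !es.
      * by move=> l /negbTE ln; rewrite /dst /= ln.
    move=> l hl; rewrite -hout // /dst /=; have -> : l == k = false by lia.
    by [].
- move=> t st1 [ht ag nb [m [i [j [k [[ei ej ek] hmk hm hout]]]]]].
  have e8' : ireg st1 8 = hi by rewrite ag.1.
  move: nb; rewrite /= ek e8' addn1 => nb; have [h1 h2 hk hs _ ho] := hm.
  have kE : k = hi by lia.
  split=> //; first by lia.
  - by rewrite -kE.
  - move=> P; rewrite -{1}kE ho [RHS](occ_cat _ _ lmh).
    by have [-> ->] : i = mid /\ j = hi by lia.
Qed.

(** Blocks are the classes of equal quotient by [w]; the last one may be cut off by [n]. *)
Definition sorted_blocks w F n := forall i j, (i <= j < n)%N ->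
  (i %/ w = j %/ w)%N -> (F i).1 <= (F j).1.

Lemma sorted_block w F n m : sorted_blocks w F n ->
  sorted_on F (m * w) (minn (m * w + w) n).
Proof.
move=> hb i j /andP[mi ij] jm; apply: hb; first by lia.
have div l : (m * w <= l < m * w + w)%N -> (l %/ w = m)%N.
  move=> /andP[h1 h2]; have w0 : (0 < w)%N by lia.
  by apply/eqP; rewrite eqn_leq leq_divRL // h1 -ltnS ltn_divLR // mulSn addnC h2.
by rewrite !div //; lia.
Qed.

Lemma wp_merge_pass st n w : ireg st 0 = n -> ireg st 5 = w -> (0 < w)%N ->
  sorted_blocks w (src st) n ->
  wp merge_pass st (fun t st' =>
    [/\ (t <= 110 * n + 20)%N, sorted_blocks (w + w) (dst st') n
      & forall P, occ (dst st') P 0 n = occ (src st) P 0 n]).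
Proof.
move=> e0 e5 w0 hb; rewrite /merge_pass; vcg; set st0 := set_ireg _ _ _.
(* After [k] rounds the output is complete up to the end of the [k]-th double block, cut off at
   [n]. *)
pose I m st1 := exists2 k,
  [/\ ireg st1 6 = minn (k * (w + w)) n,
     sorted_blocks (w + w) (dst st1) (minn (k * (w + w)) n)
   & forall P, occ (dst st1) P 0 (minn (k * (w + w)) n) =
       occ (src st) P 0 (minn (k * (w + w)) n)]
 & m = (110 * (n - minn (k * (w + w)) n) + 10)%N.
have I0 : I (110 * n + 10)%N st0.
  exists 0%N; rewrite ?mul0n ?min0n ?subn0 //; split=> // [i j|P]; first by lia.
  by rewrite !occ_geq.
apply: wp_mono; first apply: (wp_while I0).
- move=> m st1 ag [k [e6 hs ho] ->].
  have e0' : ireg st1 0 = n by rewrite ag.1.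
  have e5' : ireg st1 5 = w by rewrite ag.1.
  have es l : src st1 l = src st l by rewrite /src !ag.2.
  rewrite /= e6 e0'; case: ifPn => hlt; last by lia.
  move: hs ho; have -> : minn (k * (w + w)) n = (k * (w + w))%N by lia.
  have {}hlt : (k * (w + w) < n)%N by lia.
  have {}e6 : ireg st1 6 = (k * (w + w))%N by lia.
  move=> hs ho; vcg; rewrite /= e0' e6 e5'.
  set lo := (k * (w + w))%N; set st2 := set_ireg _ _ _.
  set mid := (n - (n - (lo + w)))%N; set hi := (n - (n - (lo + (w + w))))%N.
  have midE : mid = minn (lo + w) n by rewrite /mid; lia.
  have hiE : hi = minn (lo + (w + w)) n by rewrite /hi; lia.
  have es2 l : src st2 l = src st l by rewrite -es.
  (* The halves of the current double block are the old blocks numbered [k + k] and [(k + k).+1]. *)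
  have slo : sorted_on (src st2) lo mid.
    move=> i j h1 h2; rewrite !es2; apply: (sorted_block (m := (k + k)%N) hb).
      by move: h1; rewrite /lo mulnDl mulnDr.
    by move: h2; rewrite midE /lo mulnDl mulnDr.
  have shi : sorted_on (src st2) mid hi.
    move=> i j h1 h2; rewrite !es2; apply: (sorted_block (m := (k + k).+1) hb).
      by move: h1; rewrite midE /lo mulSn mulnDl mulnDr; lia.
    by move: h2; rewrite hiE /lo mulSn mulnDl mulnDr; lia.
  apply: wp_mono; first apply: wp_agree;
    first apply: (@wp_merge_blocks st2 lo mid hi) => //; first by rewrite midE hiE; lia.
  move=> t st3 [[ht hs3 ho3 hout] ag3]; vcg.
  have e83 : ireg st3 8 = hi by rewrite ag3.1.
  have hiE' : hi = minn (k.+1 * (w + w)) n by rewrite hiE /lo mulSn addnC.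
  exists (110 * (n - hi) + 10)%N; last by rewrite /=; lia.
  exists k.+1; rewrite -hiE' //; split=> /=; first by rewrite e83.
  + have div l : (lo <= l < hi)%N -> (l %/ (w + w) = k)%N.
      move=> /andP[h1 h2]; have ww0 : (0 < w + w)%N by lia.
      apply/eqP; rewrite eqn_leq leq_divRL // h1 -ltnS ltn_divLR // andbT.
      by rewrite mulSn addnC; move: h2; rewrite hiE /lo; lia.
    move=> i j /andP[ij jh] eqd; change ((dst st3 i).1 <= (dst st3 j).1).
    (* Either both indices lie in earlier output, which the merge leaves alone, or [i] shares the
       new block with [j]. *)
    have [jlo|loj] := ltnP j lo; first by rewrite !hout ?hs ?ij //; lia.
    have loi : (lo <= i)%N.
      move: eqd; rewrite (div j); last by rewrite loj.
      by move=> ik; rewrite /lo -{1}ik leq_trunc_div.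
    by apply: hs3; rewrite ?loi.
  + move=> P; change (occ (dst st3) P 0 hi = occ (src st) P 0 hi).
    rewrite !(@occ_cat _ _ 0 lo hi) ?ho3; try lia.
    rewrite (@eq_occ (dst st3) (dst st2)); last by move=> l /hout.
    by rewrite -ho; congr (_ + _)%N; apply: eq_occ => l _.
- move=> t st1 [ht ag nb [m [k [e6 hs ho] _]]].
  have e0' : ireg st1 0 = n by rewrite ag.1.
  move: nb; rewrite /= e6 e0' => nb.
  move: hs ho; have -> : minn (k * (w + w)) n = n by lia.
  by move=> hs ho; split=> //; lia.
Qed.

Lemma wp_copy_back st n : ireg st 0 = n ->
  wp copy_back st (fun t st' =>
    (t <= 30 * n + 10)%N /\ forall l, (l < n)%N -> src st' l = dst st l).
Proof.
move=> e0; pose I k st1 := forall l, (l < k)%N -> src st1 l = dst st l.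
apply: wp_mono; first apply: (@wp_for _ I _ _ _ n 10) => //.
- by move=> st1 ag /=; rewrite ag.1.
- move=> k st1 kn ag e4 hI; vcg; split=> //= l; rewrite ltnS => lk.
  rewrite /src /= e4; have [->|ln] := eqVneq l k.
    by rewrite /dst !ag.2.
  by apply: hI; rewrite ltn_neqAle ln.
- by move=> t st1 [ht _ hI]; split=> //; move: ht => /=; lia.
Qed.

(** [L] bounds the number of passes: with [l] passes left, [n <= w * 2 ^ l]. Each pass with its copy
    takes at most [190 * n]. *)
Lemma wp_merge_sort st n L : ireg st 0 = n -> (0 < n)%N -> (n <= 2 ^ L)%N ->
  wp merge_sort st (fun t st' =>
    [/\ (t <= 200 * n * L.+1)%N, sorted_on (src st') 0 n
      & forall P, occ (src st') P 0 n = occ (src st) P 0 n]).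
Proof.
move=> e0 n0 nL; rewrite /merge_sort; vcg; set st0 := set_ireg _ _ _.
pose I m st1 := exists w l, [/\ ireg st1 5 = w, (0 < w)%N /\ (n <= w * 2 ^ l)%N,
  m = (190 * n * l + 8)%N, sorted_blocks w (src st1) n &
  forall P, occ (src st1) P 0 n = occ (src st) P 0 n].
have I0 : I (190 * n * L + 8)%N st0.
  exists 1%N, L; split=> //; first by rewrite mul1n.
  by move=> i j _; rewrite !divn1 => ->.
apply: wp_mono; first apply: (wp_while I0).
- move=> m st1 ag [w [l [e5 [w0 nw] -> hb ho]]].
  have e0' : ireg st1 0 = n by rewrite ag.1.
  rewrite /= e5 e0' addn1; case: ifPn => wn; last by lia.
  have [l' lE] : exists l', l = l'.+1.
    by case: l nw => [|l' _]; [rewrite expn0; lia | exists l'].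
  vcg; apply: wp_mono; first apply: wp_agree; first exact: wp_merge_pass hb.
  move=> t st2 [[ht hb2 ho2] ag2].
  have e02 : ireg st2 0 = n by rewrite ag2.1.
  vcg; apply: wp_mono; first apply: wp_agree; first exact: wp_copy_back e02.
  move=> t2 st3 [[ht2 hc] ag3]; vcg.
  exists (190 * n * l' + 8)%N; last by rewrite lE mulnS /=; lia.
  have e53 : ireg st3 5 = w by rewrite ag3.1 // ag2.1.
  exists (w + w)%N, l'; split=> //=.
  + by rewrite e53.
  + by move: nw; rewrite lE expnS; lia.
  + move=> i j ij eqd; change ((src st3 i).1 <= (src st3 j).1).
    by rewrite !hc ?hb2 //; lia.
  + move=> P; rewrite -ho -ho2; apply: eq_occ => i /hc; exact.
- move=> t st1 [ht ag nb [m [w [l [e5 [w0 nw] _ hb ho]]]]].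
  have e0' : ireg st1 0 = n by rewrite ag.1.
  move: nb; rewrite /= e5 e0' => nb; split=> //; first by rewrite mulnS /=; lia.
  by move=> i j ij jn; apply: hb; rewrite ?divn_small //; lia.
Qed.

Lemma occ_perm F G n : (forall P, occ F P 0 n = occ G P 0 n) ->
  perm_eq (mkseq F n) (mkseq G n).
Proof.
move=> h; apply/permP => P.
have occE H : count P (mkseq H n) = occ H P 0 n.
  rewrite -sum1_count big_mkcond big_map /occ /index_iota subn0.
  by apply: eq_bigr => i _; case: (P _).
by rewrite !occE.
Qed.

End MergeSort.

(** * Bisection *)

(* Cells: 11, 12 = ends of the bisection interval, 13 = its midpoint theta,
   14 = accumulated divergence, 15, 16, 17 = prefix sums of q, q u and q u^2
   for u = payoff - theta. *)
Definition cell (b : nat) : rexp := RMem b (INum 0).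

Definition payoff_index : iexp :=
  IAdd (IMul (IAdd (IMul (IReg 2) (IReg 1)) (IReg 3)) (IReg 0)) (IReg 4).

Definition payoff_rexp : rexp :=
  RAdd (RMem 0 payoff_index) (RMul (cell 3) (RMem 2 (IReg 4))).

Definition fill : cmd :=
  For 4 (IReg 0) (Seq (RSet 7 (IReg 4) payoff_rexp)
                      (RSet 8 (IReg 4) (RMem 1 payoff_index))).

Definition scan_excess : rexp := RSub (RMem 7 (IReg 11)) (cell 13).

(** [U2 - u * U] is the unnormalized density of the minimizer at an entry; the prefix grows while it
    is nonnegative at the next entry. *)
Definition scan_prefix : cmd :=
  Seq (RSet 15 (INum 0) (RNum 0)) (Seq (RSet 16 (INum 0) (RNum 0))
  (Seq (RSet 17 (INum 0) (RNum 0)) (Seq (ISet 11 (INum 0))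
  (While (BAnd (BILe (IAdd (IReg 11) (INum 1)) (IReg 0))
            (BRLe (RMul scan_excess (cell 16)) (cell 17)))
     (Seq (RSet 15 (INum 0) (RAdd (cell 15) (RMem 8 (IReg 11))))
     (Seq (RSet 16 (INum 0)
             (RAdd (cell 16) (RMul (RMem 8 (IReg 11)) scan_excess)))
     (Seq (RSet 17 (INum 0) (RAdd (cell 17)
             (RMul (RMem 8 (IReg 11)) (RMul scan_excess scan_excess))))
        (ISet 11 (IAdd (IReg 11) (INum 1)))))))))).

(** After sorting, [cell 7] is the least payoff. If [theta] does not exceed it, [budget + 1] is
    added in place of a possibly infinite divergence; if [U <= 0], the divergence is 0. *)
Definition add_divergence : cmd :=
  If (BRLe (cell 13) (cell 7))
    (RSet 14 (INum 0) (RAdd (cell 14) (RAdd (cell 4) (RNum 1))))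
    (If (BRLe (cell 16) (RNum 0)) Skip
       (RSet 14 (INum 0) (RAdd (cell 14)
          (RSub (RDiv (cell 17) (RSub (RMul (cell 17) (cell 15))
                                      (RMul (cell 16) (cell 16))))
                (RNum 1))))).

Definition project_action : cmd :=
  Seq fill (Seq merge_sort (Seq scan_prefix add_divergence)).

Definition halve : cmd :=
  Seq (RSet 14 (INum 0) (RNum 0)) (Seq (For 3 (IReg 1) project_action)
    (If (BRLe (cell 14) (cell 4)) (RSet 11 (INum 0) (cell 13))
                                  (RSet 12 (INum 0) (cell 13)))).

Definition bisect : cmd :=
  Seq (RSet 12 (INum 0) (RNum 0))
    (While (BNot (BRLe (RSub (cell 11) (cell 12)) (cell 5)))
      (Seq (RSet 13 (INum 0) (RDiv (RAdd (cell 12) (cell 11)) (RNum 2)))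
         halve)).

Definition max_payoff : cmd :=
  Seq (RSet 11 (INum 0) (RNum 0))
    (For 3 (IReg 1) (For 4 (IReg 0)
      (If (BRLe (cell 11) payoff_rexp) (RSet 11 (INum 0) payoff_rexp) Skip))).

Definition bellman_prog : cmd :=
  For 2 (IReg 0)
    (Seq max_payoff (Seq bisect (RSet 6 (IReg 2) (cell 11)))).

(** * Correctness and running time of the bisection *)

Section Verification.
Variable R : realType.
Implicit Type st : state R.

Lemma wp_scan_prefix st n theta (b := rmem st 7) (q := rmem st 8)
    (u := fun i => b i - theta) : ireg st 0 = n -> (0 < n)%N ->
  rmem st 13 0 = theta ->
  wp scan_prefix st (fun t st' => (t <= 80 * n + 50)%N /\
    exists k (U := rmem st' 16 0) (U2 := rmem st' 17 0), [/\ (0 < k <= n)%N,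
      rmem st' 15 0 = \sum_(0 <= i < k) q i,
      U = \sum_(0 <= i < k) q i * u i /\ U2 = \sum_(0 <= i < k) q i * u i ^+ 2,
      u k.-1 * U <= U2 & (k < n)%N -> U2 < u k * U]).
Proof.
move=> e0 n0 e13; rewrite /scan_prefix; vcg; set st0 := set_ireg _ _ _.
pose I m st1 := exists2 k, [/\ (k <= n)%N /\ ireg st1 11 = k,
      rmem st1 15 0 = \sum_(0 <= i < k) q i,
      rmem st1 16 0 = \sum_(0 <= i < k) q i * u i,
      rmem st1 17 0 = \sum_(0 <= i < k) q i * u i ^+ 2
    & (0 < k)%N -> u k.-1 * rmem st1 16 0 <= rmem st1 17 0]
  & m = (80 * (n - k) + 20)%N.
have I0 : I (80 * n + 20)%N st0.
  by exists 0%N; rewrite ?subn0 //; split=> //; rewrite big_geq.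
apply: wp_mono; first apply: (wp_while I0).
- move=> m st1 ag [k [[kn e11] e15 e16 e17 hl] ->].
  have e0' : ireg st1 0 = n by rewrite ag.1.
  have e13' : rmem st1 13 0 = theta by rewrite ag.2.
  have eb l : rmem st1 7 l = b l by rewrite ag.2.
  have hq l : rmem st1 8 l = q l by rewrite ag.2.
  rewrite /= e11 e0' addn1 e13' eb -/(u k); case: ifPn => [/andP[ltk hle]|_]; last by lia.
  vcg; rewrite /= e11 e13' eb hq -/(u k) addn1.
  exists (80 * (n - k.+1) + 20)%N; last by lia.
  exists k.+1 => //; split=> //=.
  + by rewrite big_nat_recr //= e15.
  + by rewrite big_nat_recr //= e16.
  + by rewrite big_nat_recr //= e17 expr2.
  (* Adding an entry raises both [u k * U] and [U2] by [q k * u k ^+ 2], so the test just passed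
     still holds. *)
  + by move=> _; lra.
- move=> t st1 [ht ag nb [m [k [[kn e11] e15 e16 e17 hl] _]]].
  have e0' : ireg st1 0 = n by rewrite ag.1.
  have e13' : rmem st1 13 0 = theta by rewrite ag.2.
  have eb l : rmem st1 7 l = b l by rewrite ag.2.
  move: nb; rewrite /= e11 e0' addn1 e13' eb -/(u k) negb_and -leqNgt -ltNge => nb.
  (* With empty sums the test reads [0 <= 0], hence at least one entry is taken. *)
  have k0 : (0 < k)%N.
    rewrite lt0n; apply/eqP => k0; move: nb; rewrite k0 leqNgt n0 /=.
    by rewrite e16 e17 k0 !big_geq // mulr0 ltxx.
  split; first by rewrite /=; lia.
  exists k; split=> //; [by rewrite k0 | exact: hl |].
  by move=> ltk; move: nb; rewrite leqNgt ltk.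
Qed.

Variables (nS nA : nat) (M : rmdp R nS nA) (v : 'I_nS -> R) (eps : R).
Hypotheses (nS_gt0 : (0 < nS)%N) (nA_gt0 : (0 < nA)%N).
Hypothesis payoff_ge0 : forall s a s', 0 <= payoff M v s a s'.

(** The input lives in registers 0, 1 and banks 0 to 5. The side conditions on write sets are
    decided by computation. *)
Lemma holds_input_agree xs bs st st' : agree xs bs st st' ->
  ~~ has (leq^~ 1%N) xs -> ~~ has (leq^~ 5%N) bs ->
  holds_input M v eps st -> holds_input M v eps st'.
Proof.
move=> [ax ab] /hasPn hx /hasPn hb.
have ax' x : (x <= 1)%N -> ireg st' x = ireg st x.
  by move=> h; apply: ax; apply/negP => /hx; rewrite h.
have ab' b i : (b <= 5)%N -> rmem st' b i = rmem st b i.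
  by move=> h; apply: ab; apply/negP => /hb; rewrite h.
move=> [[h0 h1] h2 h3 [h4 h5 h6]].
split; rewrite ?ax' ?ab' //; first by move=> s a s'; rewrite !ab' //.
by move=> s; rewrite ab'.
Qed.

Lemma eval_payoff st (s s' : 'I_nS) (a : 'I_nA) : holds_input M v eps st ->
  ireg st 2 = s -> ireg st 3 = a -> ireg st 4 = s' ->
  reval st payoff_rexp = payoff M v s a s'.
Proof.
move=> [[h0 h1] h2 h3 [h4 h5 h6]] e2 e3 e4.
by rewrite /= e2 e3 e4 h0 h1 (h2 s a s').1 h4 h3.
Qed.

Lemma wp_fill st (s : 'I_nS) (a : 'I_nA) : holds_input M v eps st ->
  ireg st 2 = s -> ireg st 3 = a ->
  wp fill st (fun t st' => (t <= 60 * nS)%N /\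
    mkseq (src st') nS = pairs (payoff M v s a) (pbar M s a)).
Proof.
move=> hin e2 e3; have [[h0 h1] h2 h3 [h4 h5 h6]] := hin.
pose I k st1 := forall i : 'I_nS, (i < k)%N ->
  src st1 i = (payoff M v s a i, pbar M s a i).
apply: wp_mono; first apply: (@wp_for _ I _ _ _ nS 40) => //.
- by move=> st1 ag /=; rewrite ag.1.
- move=> k st1 kn ag e4 hI; vcg; split=> // i; rewrite ltnS => ik.
  have hin1 := holds_input_agree ag isT isT hin.
  rewrite /src /= e4; have [ikE|ln] := eqVneq (i : nat) k.
    have e2' : ireg st1 2 = s by rewrite ag.1.
    have e3' : ireg st1 3 = a by rewrite ag.1.
    rewrite -(@eval_payoff st1) //; last by rewrite e4.
    case: hin1 => [[h01 h11] h21 h31 _].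
    by rewrite /= e2' e3' e4 h01 h11 -ikE (h21 s a i).2.
  by apply: hI; rewrite ltn_neqAle ln.
- move=> t st1 [ht ag hI]; split=> //; first by move: ht => /=; lia.
  rewrite /mkseq /pairs -val_enum_ord -map_comp; apply: eq_map => i /=.
  by apply: hI; apply: ltn_ord.
Qed.

Variable L : nat.
Hypothesis nS_le : (nS <= 2 ^ L)%N.

Lemma wp_project_action st (s : 'I_nS) (a : 'I_nA) theta :
  holds_input M v eps st -> ireg st 2 = s -> ireg st 3 = a ->
  rmem st 13 0 = theta ->
  wp project_action st (fun t st' => (t <= 500 * (nS * L.+1))%N /\
    exists2 D, projects M v s a theta D & rmem st' 14 0 = rmem st 14 0 + D).
Proof.
move=> hin e2 e3 e13; rewrite /project_action; vcg.
apply: wp_mono; first apply: wp_agree; first exact: wp_fill hin e2 e3.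
move=> t1 st1 [[ht1 hL] ag1]; vcg.
have e01 : ireg st1 0 = nS by rewrite ag1.1 //; case: hin => [[]].
apply: wp_mono; first apply: wp_agree; first exact: wp_merge_sort e01 nS_gt0 nS_le.
move=> t2 st2 [[ht2 hs ho] ag2]; vcg.
have e02 : ireg st2 0 = nS by rewrite ag2.1.
have e132 : rmem st2 13 0 = theta by rewrite ag2.2 // ag1.2.
apply: wp_mono; first apply: wp_agree; first exact: wp_scan_prefix e02 nS_gt0 e132.
move=> t3 st3 [[ht3 [k [hk e15 [e16 e17] hlast hnext]]] ag3].
have hperm : perm_eq (mkseq (src st2) nS) (pairs (payoff M v s a) (pbar M s a)).
  by rewrite -hL; apply: occ_perm.
have mem2 i : (i < nS)%N -> src st2 i \in pairs (payoff M v s a) (pbar M s a).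
  by move=> hi; rewrite -(perm_mem hperm) map_f // mem_iota.
have hin3 : holds_input M v eps st3.
  apply: (holds_input_agree ag3) => //; apply: (holds_input_agree ag2) => //.
  exact: holds_input_agree ag1 _ _ hin.
have e133 : rmem st3 13 0 = theta by rewrite ag3.2.
have e143 : rmem st3 14 0 = rmem st 14 0 by rewrite ag3.2 // ag2.2 // ag1.2.
have e7 : rmem st3 7 0 = rmem st2 7 0 by rewrite ag3.2.
have e4 : rmem st3 4 0 = budget M by case: hin3 => _ _ _ [].
(* 34 bounds the cost of every branch of [add_divergence]. *)
have ltim : (t1 + (t2 + (t3 + 34)) <= 500 * (nS * L.+1))%N.
  have := leq_pmulr nS (ltn0Sn L); rewrite -mulnA in ht2; lia.
rewrite /add_divergence; vcg; rewrite /= e133 e7; case: ifPn => hth; vcg => /=.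
  split; first by apply: leq_trans ltim; lia.
  rewrite e143 e4; exists (budget M + 1) => //; right; split; first by lra.
  move=> s'; have : (payoff M v s a s', pbar M s a s') \in mkseq (src st2) nS.
    by rewrite (perm_mem hperm) map_f // mem_enum.
  case/mapP => i; rewrite mem_iota => /andP[_ hi] hE.
  apply: le_trans hth _; have := hs 0%N i (leq0n i) hi.
  by rewrite -hE.
rewrite -ltNge in hth.
have K : kkt (pairs (payoff M v s a) (pbar M s a)) theta
    (if rmem st3 16 0 <= 0 then 0 else
     rmem st3 17 0 / (rmem st3 17 0 * rmem st3 15 0 - rmem st3 16 0 ^+ 2) - 1).
  apply: (kkt_perm hperm); rewrite e15 e16 e17.
  apply: kkt_prefix => //.
  - by move=> i j /andP[ij jn]; apply: hs.
  - move=> i /mem2 /mapP[s' _ [_ ->]]; exact: pbar_gt0.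
  - have := perm_big _ hperm (op := +%R) (x := 0) (P := xpredT) (F := snd).
    rewrite big_pairs /= (pbar_simplex M s a).2 => <-.
    by rewrite big_map /index_iota subn0.
  - by rewrite -e16 -e17.
  - by move=> /hnext; rewrite e16 e17.
case: ifPn => hU; rewrite ?(negbTE hU) ?hU in K; vcg => /=.
  split; first by apply: leq_trans ltim; lia.
  by exists 0; [left | rewrite e143 addr0].
split; first by apply: leq_trans ltim; lia.
by rewrite -expr2; eexists; [left; exact: K | rewrite e143].
Qed.

(** Comparing the total divergence with the budget tells on which side of [theta] the Bellman value
    lies, by the two bounds from projections. *)
Lemma wp_halve st (s : 'I_nS) theta :
  holds_input M v eps st -> ireg st 2 = s -> rmem st 13 0 = theta ->
  wp halve st (fun t st' => (t <= 600 * (nA * (nS * L.+1)))%N /\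
    ([/\ bellman M v s <= theta, rmem st' 11 0 = theta
       & rmem st' 12 0 = rmem st 12 0] \/
     [/\ theta <= bellman M v s, rmem st' 11 0 = rmem st 11 0
       & rmem st' 12 0 = theta])).
Proof.
move=> hin e2 e13; rewrite /halve; vcg; set st0 := set_rmem _ _ _ _.
pose I k st1 := exists2 D : nat -> R, rmem st1 14 0 = \sum_(0 <= i < k) D i &
  forall a : 'I_nA, (a < k)%N -> projects M v s a theta (D a).
have hin0 : holds_input M v eps st0 by [].
apply: wp_mono; first apply: wp_agree;
  first apply: (@wp_for _ I _ _ _ nA (500 * (nS * L.+1))) => //.
- by move=> st1 ag /=; rewrite ag.1 //; case: hin => [[]].
- by exists (fun=> 0); rewrite ?big_geq.
- move=> k st1 kn ag e3 [D e14 hD].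
  have hin1 := holds_input_agree ag isT isT hin0.
  have e21 : ireg st1 2 = s by rewrite ag.1.
  have e131 : rmem st1 13 0 = theta by rewrite ag.2.
  apply: wp_mono; first exact: (@wp_project_action st1 s (Ordinal kn) theta).
  move=> t st2 [ht [Dk hDk e142]]; split=> //.
  exists (fun i => if i == k then Dk else D i).
    rewrite /= e142 e14 big_nat_recr //= eqxx; congr (_ + _).
    by apply: eq_big_nat => i /andP[_ ik]; rewrite ltn_eqF.
  move=> a; rewrite ltnS leq_eqVlt => /orP[/eqP ak|ak].
    by rewrite ak eqxx; have -> : a = Ordinal kn by apply: val_inj.
  by rewrite ltn_eqF //; apply: hD.
move=> t st1 [[ht _ [D e14 hD]] ag].
have hin1 := holds_input_agree ag isT isT hin0.
have e4 : rmem st1 4 0 = budget M by case: hin1 => _ _ _ [].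
have e131 : rmem st1 13 0 = theta by rewrite ag.2.
have DP a : projects M v s a theta (D a) by apply: hD; apply: ltn_ord.
have ltim : (t + 30 <= 600 * (nA * (nS * L.+1)))%N.
  have W0 : (0 < nS * L.+1)%N by rewrite muln_gt0 nS_gt0.
  have := leq_pmulr nA W0; move: ht nA_gt0 => /=.
  by move: (nS * L.+1)%N => W; lia.
vcg; rewrite /= e14 e4 big_mkord; case: ifPn => hle; vcg => /=; rewrite e131.
  split; first by lia.
  left; split=> //; last by rewrite ag.2.
  exact: bellman_le_of_projects DP hle.
split; first by lia.
right; split=> //; last by rewrite ag.2.
by apply: bellman_ge_of_projects DP _; rewrite // ltNge.
Qed.

Lemma wp_bisect st (s : 'I_nS) N :
  holds_input M v eps st -> ireg st 2 = s -> 0 < eps ->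
  bellman M v s <= rmem st 11 0 -> rmem st 11 0 <= eps * 2 ^+ N ->
  wp bisect st (fun t st' => (t <= 700 * (nA * (nS * L.+1)) * N.+1)%N /\
     `|rmem st' 11 0 - bellman M v s| <= eps).
Proof.
move=> hin e2 eps0 hJ hN; rewrite /bisect; vcg; set st0 := set_rmem _ _ _ _.
(* [k] bounds the number of halvings still to come; at [k = 0] the loop test must fail. *)
pose I m st1 := exists2 k, [/\ rmem st1 12 0 <= bellman M v s,
    bellman M v s <= rmem st1 11 0
  & rmem st1 11 0 - rmem st1 12 0 <= eps * 2 ^+ k]
  & m = ((600 * (nA * (nS * L.+1)) + 60) * k + 20)%N.
have hin0 : holds_input M v eps st0 by [].
have W0 : (0 < nA * (nS * L.+1))%N by rewrite !muln_gt0 nA_gt0 nS_gt0.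
have I0 : I ((600 * (nA * (nS * L.+1)) + 60) * N + 20)%N st0.
  by exists N => //; split=> //=; [exact: bellman_ge0 | rewrite subr0].
apply: wp_mono; first apply: (wp_while I0).
- move=> m st1 ag [k [h1 h2 h3] ->].
  have hin1 := holds_input_agree ag isT isT hin0.
  have e5 : rmem st1 5 0 = eps by case: hin1 => _ _ _ [].
  rewrite /= e5; case: ifPn => hgt; last by lia.
  case: k h3 => [|k] h3; first by move: hgt h3; rewrite expr0; lra.
  vcg; set st2 := set_rmem _ _ _ _.
  have e22 : ireg st2 2 = s by rewrite [LHS]ag.1.
  have hin2 : holds_input M v eps st2 by [].
  apply: wp_mono; first exact: wp_halve hin2 e22 erefl.
  rewrite exprS in h3.
  move=> t st3 [ht h]; exists ((600 * (nA * (nS * L.+1)) + 60) * k + 20)%N.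
    exists k => //; rewrite /st2 /= in h; case: h => -[h4 -> ->]; split=> //; lra.
  by rewrite mulnS /=; lia.
- move=> t st1 [ht ag nb [m [k [h1 h2 h3] _]]].
  have hin1 := holds_input_agree ag isT isT hin0.
  have e5 : rmem st1 5 0 = eps by case: hin1 => _ _ _ [].
  move: nb; rewrite /= e5 negbK => nb; split; last by rewrite ger0_norm; lra.
  by rewrite mulnS; move: ht; rewrite mulnDl; nia.
Qed.

(** The computed maximum is the initial right end of the bisection interval; [x], later [Rbar M],
    bounds its length. *)
Lemma wp_max_payoff st (s : 'I_nS) (x : R) : holds_input M v eps st ->
  ireg st 2 = s -> 0 <= x -> (forall a s', payoff M v s a s' <= x) ->
  wp max_payoff st (fun t st' => (t <= 200 * (nA * nS))%N /\
    ((forall a s', payoff M v s a s' <= rmem st' 11 0) /\ rmem st' 11 0 <= x)).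
Proof.
move=> hin e2 x0 hx; rewrite /max_payoff; vcg; set st0 := set_rmem _ _ _ _.
pose I k st1 := rmem st1 11 0 <= x /\
  forall (a : 'I_nA) s', (a < k)%N -> payoff M v s a s' <= rmem st1 11 0.
have hin0 : holds_input M v eps st0 by [].
apply: wp_mono; first apply: (@wp_for _ I _ _ _ nA (110 * nS)) => //.
- by move=> st1 ag /=; rewrite ag.1 //; case: hin => [[]].
- move=> k st1 kn ag e3 hI.
  have hin1 := holds_input_agree ag isT isT hin0.
  pose I1 j st2 := I k st2 /\ forall s' : 'I_nS, (s' < j)%N ->
    payoff M v s (Ordinal kn) s' <= rmem st2 11 0.
  apply: wp_mono; first apply: (@wp_for _ I1 _ _ _ nS 80) => //.
  + by move=> st2 ag2 /=; rewrite ag2.1 //; case: hin1 => [[]].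
  + move=> j st2 jn ag2 e4 [[h3 h4] h5].
    have hin2 := holds_input_agree ag2 isT isT hin1.
    have ep : reval st2 payoff_rexp = payoff M v s (Ordinal kn) (Ordinal jn).
      by apply: eval_payoff => //; rewrite ag2.1 // ?e3 // ag.1.
    rewrite /= in ep; vcg; rewrite /= ep; case: ifPn => hle; vcg; rewrite /= ?ep;
      split=> //; split.
    * split=> /= [|a s' ak]; rewrite ?ep //.
      by apply: le_trans hle; apply: h4.
    * move=> s' /=; rewrite ltnS leq_eqVlt ?ep => /orP[/eqP sj|sj].
        by have -> : s' = Ordinal jn by apply: val_inj.
      by apply: le_trans hle; apply: h5.
    * by split.
    * move=> s' /=; rewrite ltnS leq_eqVlt => /orP[/eqP sj|sj]; last exact: h5.
      have -> : s' = Ordinal jn by apply: val_inj.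
      by apply: ltW; rewrite ltNge.
  + move=> t st2 [ht _ [[h3 h4] h5]]; split; first by move: ht => /=; lia.
    split=> // a s' /=; rewrite ltnS leq_eqVlt => /orP[/eqP ak|ak]; last exact: h4.
    by have -> : a = Ordinal kn by [apply: val_inj]; apply: h5.
- move=> t st1 [ht ag [h1 h2]]; split.
    by move: ht (leq_pmulr nA nS_gt0) => /=; lia.
  by split=> // a s'; apply: h2.
Qed.

Lemma wp_bellman_prog st (x : R) N : holds_input M v eps st -> 0 < eps ->
  0 <= x -> (forall s a s', payoff M v s a s' <= x) -> x <= eps * 2 ^+ N ->
  wp bellman_prog st (fun t st' =>
    (t <= 1000 * (nS * (nA * (nS * L.+1)) * N.+1))%N /\
    forall s : 'I_nS, `|output nS st' s - bellman M v s| <= eps).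
Proof.
move=> hin eps0 x0 hx hN.
have [W0 W1] : (0 < nA * (nS * L.+1) * N.+1 /\
    nA * nS <= nA * (nS * L.+1) * N.+1)%N.
  by rewrite !muln_gt0 nA_gt0 nS_gt0 -mulnA leq_pmul2l // -mulnA leq_pmulr.
pose I k st1 := forall s : 'I_nS, (s < k)%N ->
  `|rmem st1 6 s - bellman M v s| <= eps.
(* The factor 920 is made up of 200 for [max_payoff], 700 for [bisect] and slack for the final
   assignment. *)
apply: wp_mono; first apply: (@wp_for _ I _ _ _ nS
  (920 * (nA * (nS * L.+1) * N.+1))) => //.
- by move=> st1 ag /=; rewrite ag.1 //; case: hin => [[]].
- move=> k st1 kn ag e2 hI; pose s := Ordinal kn.
  have hin1 := holds_input_agree ag isT isT hin.
  vcg; apply: wp_mono; first apply: wp_agree;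
    first exact: (@wp_max_payoff st1 s x hin1 e2 x0 (hx s)).
  move=> t1 st2 [[ht1 [h1 h2]] ag2].
  have hin2 := holds_input_agree ag2 isT isT hin1.
  have e22 : ireg st2 2 = s by rewrite ag2.1.
  vcg; apply: wp_mono; first apply: wp_agree;
    first apply: (@wp_bisect st2 s N hin2 e22 eps0) => //.
  + exact: bellman_le_max.
  + exact: le_trans hN.
  move=> t2 st3 [[ht2 h3] ag3]; vcg; split; first by rewrite /=; lia.
  move=> s' /=; rewrite ltnS leq_eqVlt => /orP[/eqP sk|sk].
    have -> : s' = s by apply: val_inj.
    by rewrite ag3.1 // e22 eqxx.
  by rewrite ag3.1 // e22 ltn_eqF // ag3.2 // ag2.2 //; apply: hI.
- move=> t st1 [ht ag h]; split=> [|s]; last exact: h.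
  have := leq_pmulr nS W0; move: ht nS_gt0; rewrite /= -[X in (1000 * X)%N]mulnA.
  by move: (_ * N.+1)%N => W; lia.
Qed.

End Verification.

(** * Logarithmic factors and the final complexity bound *)

Section Main.
Variable R : realType.

(** [N] is the least exponent with [x <= 2 ^+ N], so [N] exceeds the binary logarithm by less than 1
    when [1 < x]. The constant absorbs the change of base and the additive terms. *)
Lemma exp2_ge_log : exists2 K : R, 0 <= K & forall x : R,
  exists2 N : nat, x <= 2 ^+ N & N.+1%:R <= K * Num.max 1 (ln x).
Proof.
have ln2 : 0 < ln 2 :> R by rewrite ln_gt0 // ltr1n.
exists (2 + (ln 2)^-1) => [|x]; first by rewrite addr_ge0 // invr_ge0 ltW.
have [x1|x1] := leP x 1.
  exists 0%N; rewrite ?expr0 //.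
  apply: (@le_trans _ _ ((2 + (ln 2)^-1) * 1)).
    by rewrite mulr1 -[1%:R]addr0 lerD ?ler1n // invr_ge0 ltW.
  by rewrite ler_wpM2l ?addr_ge0 ?invr_ge0 ?(ltW ln2) // le_max lexx.
have ex : exists N : nat, x <= 2 ^+ N.
  exists (Num.bound x); apply: ltW; apply: lt_le_trans (archi_boundP _) _.
    by rewrite ltW // (lt_trans ltr01).
  by rewrite -natrX ler_nat ltnW // ltn_expl.
case: (ex_minnP ex) => -[|N] hN hmin; first by move: hN; rewrite expr0 leNgt x1.
exists N.+1 => //.
have xN : 2 ^+ N < x by rewrite ltNge; apply/negP => /hmin; rewrite ltnn.
have : N%:R * ln 2 < ln x.
  by rewrite mulr_natl -lnXn // ltr_ln ?posrE ?exprn_gt0 // (lt_trans ltr01).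
rewrite -ltr_pdivlMr // => hlt.
have l0 : 0 <= (ln 2)^-1 :> R by rewrite invr_ge0 ltW.
have h1 : 1 <= Num.max 1 (ln x) by rewrite le_max lexx.
have h2 : ln x <= Num.max 1 (ln x) by rewrite le_max lexx orbT.
have h3 : ln x / ln 2 <= (ln 2)^-1 * Num.max 1 (ln x) by rewrite mulrC ler_wpM2l.
rewrite -addn2 natrD mulrDl; lra.
Qed.

End Main.

(** Logarithms are cut off below at 1, since [ln 1 = 0] and [ln (Rbar M / eps)] may be negative
    while the program still takes time. Program and constant are chosen before the sizes and the
    data. *)
Theorem corollary4 (R : realType) :
  exists (prog : cmd) (C : R),
    forall (nS nA : nat), (0 < nS)%N -> (0 < nA)%N ->
    forall (M : rmdp R nS nA) (v : 'I_nS -> R) (eps : R),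
      0 < eps ->
      (forall s : 'I_nS, v s <= vstar M s) ->
      (forall (s : 'I_nS) (a : 'I_nA) (s' : 'I_nS),
          0 <= rew M s a s' + disc M * v s') ->
      forall st : state R, holds_input M v eps st ->
      exists (t : nat) (st' : state R),
        [/\ exec prog st t st',
            dist_infty (output nS st') (bellman M v) <= eps
          & t%:R <= C * (nS%:R ^+ 2 * Num.max 1 (ln nS%:R) * nA%:R *
                         Num.max 1 (ln (Rbar M / eps)))].
Proof.
have [K K0 hK] := exp2_ge_log R.
(* One factor [K] pays for the sorting passes, the other for the bisection steps. *)
exists bellman_prog, (1000 * K ^+ 2) => nS nA nS0 nA0 M v eps eps0 hv hpos st hin.
have [L hL hLK] := hK nS%:R; have [N hN hNK] := hK (Rbar M / eps).
have nSL : (nS <= 2 ^ L)%N by rewrite -(ler_nat R) natrX.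
(* Here [v <= vstar] enters: it makes the initial bisection interval no longer than [Rbar M]. *)
have hR s a s' : payoff M v s a s' <= Rbar M.
  apply: le_trans (Rbar_fixpoint M s a s'); rewrite lerD2l ler_pM2l ?disc_gt0 //.
  by apply: le_trans (hv s') _; apply: vstar_le_Rbar.
have hRN : Rbar M <= eps * 2 ^+ N by rewrite mulrC -ler_pdivrMr.
have [t [st' [he [ht hd]]]] :=
  wp_bellman_prog nS0 nA0 hpos nSL hin eps0 (Rbar_ge0 M) hR hRN.
exists t, st'; split=> //.
  by apply: bigmax_le => [|s _]; [apply: ltW | apply: hd].
move: ht; rewrite -(ler_nat R) => /le_trans; apply.
rewrite !natrM.
have -> : nS%:R * (nA%:R * (nS%:R * L.+1%:R)) * N.+1%:R =
  (nS%:R ^+ 2 * nA%:R) * (L.+1%:R * N.+1%:R) :> R by ring.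
set mS := Num.max 1 (ln nS%:R); set mR := Num.max 1 (ln (_ / _)).
have -> : 1000 * K ^+ 2 * (nS%:R ^+ 2 * mS * nA%:R * mR) =
  1000 * ((nS%:R ^+ 2 * nA%:R) * ((K * mS) * (K * mR))) by ring.
rewrite ler_wpM2l // ler_wpM2l ?mulr_ge0 ?exprn_ge0 //.
by apply: ler_pM.
Qed.
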